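(* Let $\mathcal{L}_n$ be the set of layered permutations in $S_n$ and $\mathcal{DL}_n$ the set of doubly layered permutations in $S_n$. Set \[v(n):=\max_{w\in\mathcal{L}_n}\mathfrak{S}_w(1,\ldots,1),\qquad \tilde v(n):=\max_{w\in\mathcal{DL}_n}\Phi_w .\] Then the limit $\lim_{n\to\infty}\frac{\log_2\tilde v(n)}{n^2}$ exists and \[\lim_{n\to\infty}\frac{\log_2\tilde v(n)}{n^2}=\frac12\lim_{n\to\infty}\frac{\log_2 v(n)}{n^2}=\frac{\gamma}{2\log 2}\approx 0.1466 .\]
   Context: $\mathfrak{S}_w$ is the Schubert polynomial of $w$, and $\Phi_w:=|\mathfrak{S}_w(1,-1,1,-1,\ldots)|$ (evaluation at $x_i=(-1)^{i-1}$). For $u\in S_m$, $v\in S_p$, $u\times v:=(u_1,\ldots,u_m,v_1+m,\ldots,v_p+m)\in S_{m+p}$. Let $w_0(p)=(p,p-1,\ldots,1)$. A layered permutation is $w(b_1,\ldots,b_k)=w_0(b_1)\times\cdots\times w_0(b_k)$ with $b_i$ positive integers. For $N\ge1$ let $\tilde w_0(N):=(N-1,N,N-3,N-2,\ldots)$, i.e. $(N-1,N,N-3,N-2,\ldots,1,2)$ for $N$ even and $(N-1,N,N-3,N-2,\ldots,2,3,1)$ for $N$ odd. A doubly layered permutation in $S_n$ is $w_2(2b_1,\ldots,2b_{k-1},2b_k+r):=\tilde w_0(2b_1)\times\cdots\times\tilde w_0(2b_{k-1})\times\tilde w_0(2b_k+r)$, where the $b_i$ are positive integers, $n=2b_1+\cdots+2b_k+r$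 and $r\in\{0,1\}$ is $n \bmod 2$. The constant $\gamma\approx 0.2032558981$ is the universal constant for which (by a theorem of Morales, Pak and Panova) $\lim_{n\to\infty}\frac{\log v(n)}{n^2}=\gamma$ (natural logarithm). *)

(* Defs.v *)
From HB Require Import structures.
From mathcomp Require Import all_boot all_order all_fingroup all_algebra.
From mathcomp Require Import boolp classical_sets reals exp.
From mathcomp Require Import mpoly.

Set Implicit Arguments.
Unset Strict Implicit.
Unset Printing Implicit Defensive.

Import Order.TTheory GRing.Theory Num.Theory.
Local Open Scope ring_scope.

(* Indices are 0-based: the variable x_{i+1} is 'X_i, and w : 'S_n maps
   i to w(i+1) - 1. *)

Section Schubert.
Variable n : nat.
Implicit Types (i j : 'I_n) (w : 'S_n) (f g : {mpoly int[n]}).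

(* (f - s_ij f) / (x_i - x_j), where s_ij exchanges x_i and x_j: for i != j
   the quotient exists, and it is unique as {mpoly int[n]} is an integral
   domain. *)
Definition divided_difference i j f : {mpoly int[n]} :=
  xget 0 [set g | ('X_i - 'X_j) * g = f - msym (tperm i j) f].

Definition staircase : {mpoly int[n]} := \prod_(i < n) 'X_i ^+ (n - i.+1).

Definition ascent w (p : 'I_n * 'I_n) : bool :=
  (p.2 == p.1.+1 :> nat) && (w p.1 < w p.2)%N.

Definition noninversions w : nat :=
  #|[set p : 'I_n * 'I_n | (p.1 < p.2)%N && (w p.1 < w p.2)%N]|.

(* In {perm _} the product s * t applies s first, so [tperm i j * w] is the
   permutation usually written w s_i: it exchanges the values of w at the
   adjacent positions i and j = i + 1. *)
Fixpoint schubert_rec (k : nat) w : {mpoly int[n]} :=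
  if k is k'.+1 then
    if [pick p | ascent w p] is Some (i, j) then
      divided_difference i j (schubert_rec k' (tperm i j * w)%g)
    else staircase
  else staircase.

(* S_{w0} = x_1^{n-1} x_2^{n-2} ... x_{n-1}, and S_w = d_i S_{w s_i} when
   w(i) < w(i+1). Each step removes exactly one non-inversion and only w0 has
   none, so the counter reaches 0 exactly at w0. The braid relations for the
   d_i make the result independent of the ascents that are picked. *)
Definition schubert w : {mpoly int[n]} := schubert_rec (noninversions w) w.

Definition schubert_at_ones w : int := (schubert w).@[fun=> 1].

Definition Phi w : int := `|(schubert w).@[fun i => (-1) ^+ i]|.

End Schubert.

(* One-line notation, with values in {1, ..., n}. *)
Definition oneline n (w : 'S_n) : seq nat :=
  [seq (nat_of_ord (w i)).+1 | i <- enum 'I_n].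

Definition perm_times (u v : seq nat) : seq nat :=
  u ++ [seq (x + size u)%N | x <- v].

Definition perm_prod (us : seq (seq nat)) : seq nat :=
  foldr perm_times [::] us.

Definition longest (p : nat) : seq nat := rev (iota 1 p).

Fixpoint tlongest (N : nat) : seq nat :=
  match N with
  | 0 => [::]
  | 1 => [:: 1%N]
  | (N'.+1 as M).+1 => M :: N :: tlongest N'
  end.

Definition layered n (w : 'S_n) : Prop :=
  exists b : seq nat,
    [/\ all (leq 1) b, sumn b = n & oneline w = perm_prod (map longest b)].

Definition doubly_layered n (w : 'S_n) : Prop :=
  exists (b : seq nat) (bk : nat),
    let blocks := rcons (map double b) (bk.*2 + odd n)%N in
    [/\ all (leq 1) (rcons b bk), sumn blocks = n
      & oneline w = perm_prod (map tlongest blocks)].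

(* The default value 0 of the maxima is harmless: the values of Phi are
   nonnegative, and the identity is layered with Schubert polynomial 1. It is
   the value of vtilde only where there is no doubly layered permutation
   (n <= 1). *)
Definition v (n : nat) : int :=
  \big[Num.max/0]_(w : 'S_n | `[< layered w >]) schubert_at_ones w.

Definition vtilde (n : nat) : int :=
  \big[Num.max/0]_(w : 'S_n | `[< doubly_layered w >]) Phi w.

Definition log2 (R : realType) (x : R) : R := ln x / ln 2.

(* Main.v *)
Require Import Defs.
From mathcomp Require Import all_boot all_order all_fingroup all_algebra.
From mathcomp Require Import mpoly ring lra zify.
From mathcomp Require Import boolp classical_sets reals topology normedtype sequences.
From mathcomp Require Import derive realfun exp.

(** Repairing the first ascent at each step, the definition of S_w becomes the
    product of divided differences along an insertion sort of w, applied to the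
    staircase monomial, so that no braid relation is needed.  In this product the
    last block of a (doubly) layered permutation, sitting on top of [m] letters,
    contributes a determinant of complete homogeneous polynomials which is
    symmetric in the first [m] variables and therefore factors out.

    At x_i = 1 the determinant of w0(p) has entries C(m+p-1-a+b, m+a) and reduces
    to a Vandermonde determinant, with value
      F(m,p) = prod_(i < j < p) (2m+i+j+1) / (i+j+1).
    At x_i = (-1)^(i-1), with m = 2M, the polynomials of odd degree vanish, hence
    the determinant splits according to parity of rows and columns, and the block
    of size N contributes F(M, floor(N/2)) F(M, ceil(N/2)) up to sign.  Thus
      v(floor(n/2))^2 <= vtilde(n) <= v(ceil(n/2))^2.

    Since c |-> (2m+c)/c is log-convex, F(km,kp) >= F(m,p)^(k^2), whence
    v(kn) >= v(n)^(k^2), and ln v(n) / n^2 converges to its supremum gamma.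
    Comparing sums with integrals, 2 ln F(m,p) is (m+p)^2 h(p/(m+p)) up to lower
    order terms, for an explicit function h.  Then gamma is the maximum of
    h(t) / (2t(2-t)) on (0,1); it is bounded below by the value at t = 4/7 and
    above by tangents at 13/23 and 4/7 to h(t) - 2ct(2-t). *)

Set Implicit Arguments.
Unset Strict Implicit.
Unset Printing Implicit Defensive.

Import Order.TTheory GRing.Theory Num.Theory.
Import numFieldNormedType.Exports.
Local Open Scope ring_scope.

(** * Divided differences and complete homogeneous polynomials *)

(** The quotient h(t) / (2t(2-t)) comes from the last block. With tn letters on top of (1-t)n, the
    limit L satisfies L n^2 >= L (1-t)^2 n^2 + h(t) n^2 / 2. Conversely c t(2-t) n^2 is c((m+p)^2 -
    m^2) for m = (1-t)n and p = tn, so a bound of this shape on each block telescopes over a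
    composition, whatever the number of blocks. The comparison of sums with integrals leaves an
    error linear in p. The scaling inequality removes it from the upper bound: apply the comparison
    to (km, kp), divide by k^2, and let k grow. The factor 1/2 in the limit is 2 (n/2)^2 / n^2: a
    doubly layered permutation behaves like the square of a layered one of half the size. The points
    13/23 and 4/7 enclose the maximiser. The logarithms of t, 1-t and 2-t there involve only the
    primes 2, 3, 5, 7, 11, 13, 23, which are pinned down by seven pairs of consecutive integers
    composed of these primes. *)

Section DividedDifferences.
Variable n : nat.
Implicit Types f g : {mpoly int[n.+1]}.

Definition xvar (i : nat) : {mpoly int[n.+1]} := 'X_(inord i).

Definition swapx (i : nat) : {mpoly int[n.+1]} -> {mpoly int[n.+1]} :=
  msym (tperm (inord i) (inord i.+1)).

Definition ddiff (i : nat) : {mpoly int[n.+1]} -> {mpoly int[n.+1]} :=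
  divided_difference (inord i) (inord i.+1).

Lemma swapxD i : {morph swapx i : f g / f + g}. Proof. exact: msymD. Qed.
Lemma swapxM i : {morph swapx i : f g / f * g}. Proof. exact: msymM. Qed.
Lemma swapx0 i : swapx i 0 = 0. Proof. exact: msym0. Qed.
Lemma swapxN i : {morph swapx i : f / - f}. Proof. exact: msymN. Qed.
Lemma swapx1 i : swapx i 1 = 1. Proof. exact: msym1. Qed.

Lemma swapx_exp i f k : swapx i (f ^+ k) = swapx i f ^+ k.
Proof. by elim: k => [|k IH]; rewrite ?expr0 ?swapx1 // !exprS swapxM IH. Qed.

Lemma swapx_sum i (I : Type) (r : seq I) (Q : pred I) (F : I -> _) :
  swapx i (\sum_(j <- r | Q j) F j) = \sum_(j <- r | Q j) swapx i (F j).
Proof. by apply: big_morph; [exact: swapxD | exact: swapx0]. Qed.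

Lemma swapx_prod i (I : Type) (r : seq I) (Q : pred I) (F : I -> _) :
  swapx i (\prod_(j <- r | Q j) F j) = \prod_(j <- r | Q j) swapx i (F j).
Proof. by apply: big_morph; [exact: swapxM | exact: swapx1]. Qed.

Lemma swapx_sub_det i (k : nat) (A : 'M[{mpoly int[n.+1]}]_k) :
  (forall a b, swapx i (A a b) = A a b) -> swapx i (\det A) = \det A.
Proof.
move=> sA; rewrite /determinant swapx_sum; apply: eq_bigr => s _.
rewrite swapxM swapx_prod -{2}[(-1) ^+ s]mulr1; congr (_ * _).
  by rewrite mulr1 swapx_exp /swapx msymN msym1.
by apply: eq_bigr => a _; exact: sA.
Qed.

Lemma swapx_var i j : swapx i 'X_j = 'X_(tperm (inord i) (inord i.+1) j).
Proof. by rewrite /swapx /msym mmapX mmap1U. Qed.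

Lemma inord_eq i j : (i <= n)%N -> (j <= n)%N ->
  (inord i == inord j :> 'I_n.+1) = (i == j).
Proof. by move=> hi hj; rewrite -val_eqE /= !inordK. Qed.

Lemma swapx_l i : swapx i (xvar i) = xvar i.+1.
Proof. by rewrite swapx_var tpermL. Qed.

Lemma swapx_r i : swapx i (xvar i.+1) = xvar i.
Proof. by rewrite swapx_var tpermR. Qed.

Lemma swapx_other i j : (i < n)%N -> (j <= n)%N -> j != i -> j != i.+1 ->
  swapx i (xvar j) = xvar j.
Proof.
move=> hi hj ji ji1; rewrite swapx_var tpermD // inord_eq // 1?eq_sym //.
exact: ltnW.
Qed.

Lemma xvarB_neq0 i : (i < n)%N -> xvar i - xvar i.+1 != 0.
Proof.
move=> hi; rewrite subr_eq0; apply/eqP => /(congr1 (fun p => p@_U_(inord i))).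
rewrite !mcoeffXU eqxx inord_eq ?(ltnW hi) //.
by rewrite -[i.+1 == i]negbK neq_ltn ltnSn orbT.
Qed.

(** The working characterisation of [ddiff]: a quotient [g] exists, so [xget] does not fall back on
    0, and cancellation in an integral domain identifies its choice with [g]. *)
Lemma ddiff_unique i f g : (i < n)%N ->
  (xvar i - xvar i.+1) * g = f - swapx i f -> ddiff i f = g.
Proof.
move=> hi hg; rewrite /ddiff /divided_difference; case: xgetP => [h _ /= hh|/(_ g)].
  by apply: (mulfI (xvarB_neq0 hi)); rewrite hg -hh.
by move=> /(_ hg).
Qed.

Lemma ddiff_exists i f : (i < n)%N ->
  exists g, (xvar i - xvar i.+1) * g = f - swapx i f.
Proof.
move=> hi.
have hM p q : (exists g, (xvar i - xvar i.+1) * g = p - swapx i p) ->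
    (exists g, (xvar i - xvar i.+1) * g = q - swapx i q) ->
    exists g, (xvar i - xvar i.+1) * g = p * q - swapx i (p * q).
  (* The twisted Leibniz rule; it reduces existence to single variables. *)
  move=> [g hg] [h hh]; exists (g * q + swapx i p * h).
  by rewrite swapxM mulrDr mulrA hg mulrCA hh; ring.
elim/mpolyind: f => [|c m p _ _ [g hg]]; first by exists 0; rewrite swapx0; ring.
suff [h hh] : exists h, (xvar i - xvar i.+1) * h = 'X_[m] - swapx i 'X_[m].
  exists (c *: h + g); rewrite swapxD mulrDr hg -scalerAr hh scalerBr.
  by rewrite /swapx msymZ; ring.
rewrite mpolyXE_id; elim/big_ind: _ => [|p1 p2|j _]; last 1 first.
- elim: (m j) => [|k IH]; first by exists 0; rewrite expr0 swapx1; ring.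
  rewrite exprS; apply: (hM _ _ _ IH); rewrite swapx_var.
  case: tpermP => [->|->|_ _]; last by exists 0; ring.
    by exists 1; rewrite /xvar; ring.
  by exists (-1); rewrite /xvar; ring.
- by exists 0; rewrite swapx1; ring.
exact: hM.
Qed.

Lemma ddiffP i f : (i < n)%N -> (xvar i - xvar i.+1) * ddiff i f = f - swapx i f.
Proof. by move=> hi; have [g hg] := ddiff_exists f hi; rewrite (ddiff_unique hi hg). Qed.

Lemma ddiffD i f g : (i < n)%N -> ddiff i (f + g) = ddiff i f + ddiff i g.
Proof. by move=> hi; apply: ddiff_unique => //; rewrite mulrDr !ddiffP // swapxD; ring. Qed.

Lemma ddiff0 i : (i < n)%N -> ddiff i 0 = 0.
Proof. by move=> hi; apply: ddiff_unique => //; rewrite swapx0; ring. Qed.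

Lemma ddiffMr i f g : (i < n)%N -> swapx i g = g -> ddiff i (f * g) = ddiff i f * g.
Proof. by move=> hi hg; apply: ddiff_unique => //; rewrite mulrA ddiffP // swapxM hg; ring. Qed.

Lemma xvarE i : xvar i = 'X_(inord i). Proof. by []. Qed.

Lemma ddiff_ord (i j : 'I_n.+1) f : j = i.+1 :> nat ->
  divided_difference i j f = ddiff i f.
Proof. by move=> hij; rewrite /ddiff -hij !inord_val. Qed.

#[local] Opaque xvar swapx ddiff.

(** The last letter of the word acts first. *)
Definition ddiffs (s : seq nat) f := foldr ddiff f s.

Lemma ddiffs_cat s t f : ddiffs (s ++ t) f = ddiffs s (ddiffs t f).
Proof. exact: foldr_cat. Qed.

Lemma ddiffsD s f g : all (fun i => i < n)%N s ->
  ddiffs s (f + g) = ddiffs s f + ddiffs s g.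
Proof. by elim: s => //= i s IH /andP[hi hs]; rewrite IH // ddiffD. Qed.

Lemma ddiffs0 s : all (fun i => i < n)%N s -> ddiffs s 0 = 0.
Proof. by elim: s => //= i s IH /andP[hi hs]; rewrite IH // ddiff0. Qed.

Lemma ddiffs_sum s (I : Type) (r : seq I) (F : I -> _) :
  all (fun i => i < n)%N s ->
  ddiffs s (\sum_(j <- r) F j) = \sum_(j <- r) ddiffs s (F j).
Proof. by move=> hs; apply: big_morph => [f g|]; [exact: ddiffsD | exact: ddiffs0]. Qed.

Lemma ddiffsMr s f g : all (fun i => i < n)%N s ->
  (forall i : nat, i \in s -> swapx i g = g) -> ddiffs s (f * g) = ddiffs s f * g.
Proof.
elim: s => //= i s IH /andP[hi hs] hg; rewrite IH // => [|j js].
  by rewrite ddiffMr // hg // mem_head.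
by apply: hg; rewrite inE js orbT.
Qed.

(* [hsym s r N] is the complete homogeneous polynomial of degree N - r + 1 in
   the r variables x_s, ..., x_{s+r-1} (zero if N < r - 1), that is, the divided
   difference of the power x^N at these r points. *)
Fixpoint hsym (s r N : nat) {struct r} : {mpoly int[n.+1]} :=
  if r is r'.+1 then
    (fix hsym_s N := if N is N'.+1 then xvar s * hsym_s N' + hsym s.+1 r' N'
                     else (r' == 0)%:R) N
  else 0.

Arguments hsym : simpl never.

Lemma hsymS s r N : hsym s r.+1 N.+1 = xvar s * hsym s r.+1 N + hsym s.+1 r N.
Proof. by []. Qed.

Lemma hsym0 s r : hsym s r 0 = (r == 1)%:R.
Proof. by case: r. Qed.

Lemma hsym1 s N : hsym s 1 N = xvar s ^+ N.
Proof. by elim: N => // N IH; rewrite hsymS IH addr0 exprS. Qed.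

Lemma hsym_small s r N : (N.+1 < r)%N -> hsym s r N = 0.
Proof.
elim: r s N => // r IH s N; elim: N => [|N IHN]; first by case: r {IH}.
by move=> h; rewrite hsymS IHN 1?ltnW // mulr0 add0r IH.
Qed.

Lemma hsymSr s r N :
  hsym s r.+1 N.+1 = xvar (s + r) * hsym s r.+1 N + hsym s r N.
Proof.
elim: r s N => [|r IH] s N; first by rewrite hsymS addn0.
elim: N => [|N IHN].
  by rewrite hsymS !hsym0; case: r {IH} => [|r] /=; rewrite ?mulr0.
rewrite [RHS](congr2 +%R (congr1 _ (hsymS s r.+1 N)) (hsymS s r N)).
rewrite hsymS IHN IH addSnnS; ring.
Qed.

(** Eliminating the polynomials without x_s gives a recursion that is visibly symmetric in x_s and
    x_(s+1); the symmetry of [hsym] rests on it. *)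
Lemma hsymSS s r N : hsym s r.+2 N.+2 =
  (xvar s + xvar s.+1) * hsym s r.+2 N.+1 - xvar s * xvar s.+1 * hsym s r.+2 N
  + hsym s.+2 r N.
Proof.
rewrite (hsymS s r.+1 N.+1) (hsymS s.+1 r N).
have -> : hsym s.+1 r.+1 N = hsym s r.+2 N.+1 - xvar s * hsym s r.+2 N.
  by rewrite (hsymS s r.+1 N); ring.
ring.
Qed.

Lemma hsym_swap_out s r N i : (i < n)%N -> (s + r <= n.+1)%N ->
  (i.+1 < s)%N || (s + r <= i)%N -> swapx i (hsym s r N) = hsym s r N.
Proof.
move=> hi; elim: r s N => [|r IH] s N hs his; first by rewrite swapx0.
elim: N => [|N IHN]; first by rewrite hsym0; case: eqP => _; rewrite ?swapx1 ?swapx0.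
rewrite hsymS swapxD swapxM IHN IH; [|lia|lia].
by rewrite swapx_other //; lia.
Qed.

Lemma hsym_swap s r N i : (i < n)%N -> (s + r <= n.+1)%N ->
  (s <= i)%N && (i.+1 < s + r)%N -> swapx i (hsym s r N) = hsym s r N.
Proof.
move=> hi; elim: r s N => [|r IH] s N hs his; first by rewrite swapx0.
have [si|si] := eqVneq s i.
  case: r IH hs his => [|r] IH hs his; first by lia.
  suff : swapx i (hsym s r.+2 N) = hsym s r.+2 N /\
         swapx i (hsym s r.+2 N.+1) = hsym s r.+2 N.+1 by case.
  elim: N => [|N [IH1 IH2]].
    by rewrite hsymS !hsym0; case: r {IH hs his} => [|r];
      rewrite ?mulr0 ?addr0 ?add0r ?swapx1 ?swapx0.
  split=> //; rewrite hsymSS !swapxD swapxN !swapxM swapxD.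
  rewrite IH1 IH2.
  rewrite (hsym_swap_out (s := s.+2)); [|lia|lia|lia].
  rewrite si swapx_l swapx_r; ring.
elim: N => [|N IHN]; first by rewrite hsym0; case: eqP => _; rewrite ?swapx1 ?swapx0.
rewrite hsymS swapxD swapxM IHN IH; [|lia|lia].
by rewrite swapx_other //; lia.
Qed.


Lemma hsym_diag s r : hsym s r.+1 r = 1.
Proof.
elim: r s => [|r IH] s; first by rewrite hsym0.
by rewrite hsymS IH hsym_small // mulr0 add0r.
Qed.

Lemma hsym_sum s r N :
  hsym s r.+2 N = \sum_(b < N) xvar s ^+ (N.-1 - b) * hsym s.+1 r.+1 b.
Proof.
elim: N => [|N IH]; first by rewrite big_ord0 hsym0.
rewrite hsymS IH big_ord_recr /= subnn expr0 mul1r; congr (_ + _).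
rewrite mulr_sumr; apply: eq_bigr => b _; rewrite mulrA -exprS; congr (_ ^+ _ * _).
by case: b => b /=; lia.
Qed.

Definition stair (s m : nat) := \prod_(i < m) xvar (s + i) ^+ (m - i.+1).

Lemma stairS s m : stair s m.+1 = xvar s ^+ m * stair s.+1 m.
Proof.
rewrite /stair big_ord_recl addn0 subn1; congr (_ * _).
by apply: eq_bigr => i _; rewrite addSnnS.
Qed.

Lemma swapx_stair i s m : (i < n)%N -> (s + m <= n.+1)%N -> (i.+1 < s)%N ->
  swapx i (stair s m) = stair s m.
Proof.
move=> hi hs his; rewrite swapx_prod; apply: eq_bigr => -[j hj] _ /=.
by rewrite swapx_exp swapx_other //; lia.
Qed.

Lemma iota_ltn s m : (s + m <= n)%N -> all (fun i => i < n)%N (rev (iota s m)).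
Proof. by move=> h; apply/allP => i; rewrite mem_rev mem_iota; lia. Qed.

Lemma ddiff_monomial s N m : (s < n)%N -> ddiff s (xvar s ^+ N * xvar s.+1 ^+ m) =
  \sum_(b < N) xvar s ^+ (m + (N.-1 - b)) * xvar s.+1 ^+ b
  - \sum_(b < m) xvar s ^+ (N + (m.-1 - b)) * xvar s.+1 ^+ b.
Proof.
move=> hs; apply: ddiff_unique => //.
rewrite swapxM !swapx_exp swapx_l swapx_r.
set x := xvar s; set y := xvar s.+1.
under eq_bigr do rewrite exprD -mulrA.
under [X in _ * (_ - X)]eq_bigr do rewrite exprD -mulrA.
(* The two sums are the quotients of x^m (x^N - y^N) and x^N (x^m - y^m); subtracting them avoids
   comparing N with m. *)
rewrite -!mulr_sumr mulrBr ![(x - y) * (_ * _)]mulrCA -!subrXX.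
ring.
Qed.

(** A run of divided differences s, s+1, ..., s+m-1 (in order of action) turns a power of x_s into
    its divided difference at m+1 points; the staircase factors lose one degree per step and shift
    down by one variable. *)
Lemma ddiffs_monomial s m N : (s + m <= n)%N ->
  ddiffs (rev (iota s m)) (xvar s ^+ N * stair s.+1 m) = stair s m * hsym s m.+1 N.
Proof.
elim: m s N => [|m IH] s N hs.
  by rewrite /stair !big_ord0 mul1r mulr1 hsym1.
have hall : all (fun i => i < n)%N (rev (iota s.+1 m)) by apply: iota_ltn; lia.
rewrite /= rev_cons -cats1 ddiffs_cat /= stairS mulrA.
rewrite ddiffMr ?ddiff_monomial; [|lia|lia|by rewrite swapx_stair //; lia].
have chain a b : ddiffs (rev (iota s.+1 m))
    (xvar s ^+ a * xvar s.+1 ^+ b * stair s.+2 m) =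
    xvar s ^+ a * (stair s.+1 m * hsym s.+1 m.+1 b).
  rewrite -mulrA mulrC ddiffsMr; [|by []|].
    by rewrite IH; [rewrite mulrC|lia].
  by move=> i; rewrite mem_rev mem_iota => hi; rewrite swapx_exp swapx_other //; lia.
(* [ddiffs] is only known to be additive, so the sign travels as an invariant factor -1. *)
have -> : forall A B C : {mpoly int[n.+1]}, (A - B) * C = A * C + (- 1) * (B * C).
  by move=> *; ring.
rewrite ddiffsD // !mulr_suml [X in _ + ddiffs _ X]mulrC ddiffsMr //; last first.
  by move=> i _; rewrite swapxN swapx1.
(* In the second sum the exponent of x_(s+1) is below m, too small for a divided difference at m+1
   points. *)
rewrite !ddiffs_sum // [X in _ + X * _]big1 => [|b _]; last first.
  by rewrite chain hsym_small ?mulr0 //; case: b => b /=; lia.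
rewrite mul0r addr0 stairS hsym_sum mulr_sumr; apply: eq_bigr => b _.
rewrite chain exprD; ring.
Qed.

(** A flagged Jacobi-Trudi determinant: row [a] uses its own number [r a] of variables, and degrees
    increase along the columns. *)
Definition hdet (k s : nat) (N r : nat -> nat) : {mpoly int[n.+1]} :=
  \det (\matrix_(a < k, b < k) hsym s (r a) (N a + b)%N).

Lemma eq_hdet k s N r N' r' : (forall a, (a < k)%N -> N a = N' a) ->
  (forall a, (a < k)%N -> r a = r' a) -> hdet k s N r = hdet k s N' r'.
Proof.
by move=> hN hr; congr (\det _); apply/matrixP => a b; rewrite !mxE hN // hr.
Qed.

Lemma swapx_hdet i k s N r :
  (forall a b, (a < k)%N -> swapx i (hsym s (r a) b) = hsym s (r a) b) ->
  swapx i (hdet k s N r) = hdet k s N r.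
Proof. by move=> h; apply: swapx_sub_det => a b; rewrite mxE h. Qed.

Definition fcons (x : nat) (f : nat -> nat) (a : nat) := if a is a'.+1 then f a' else x.

(** Subtract x_s times the preceding column from each column. The new first row, made of powers of
    x_s, becomes (x_s^N0, 0, ..., 0), and by [hsymS] the other rows lose the variable x_s. [W] is
    this unitriangular column operation. *)
Lemma hdet_cons k s N0 N r : xvar s ^+ N0 * hdet k s.+1 N r =
  hdet k.+1 s (fcons N0 N) (fcons 1 (fun a => (r a).+1)).
Proof.
rewrite /hdet; set A := (X in _ = \det X).
pose W : 'M[{mpoly int[n.+1]}]_k.+1 :=
  \matrix_(c, b) ((c == b)%:R - xvar s * (c.+1 == b :> nat)%:R).
have dW : \det W = 1.
  rewrite -det_tr det_trig.
    by rewrite big1 // => i _; rewrite !mxE eqxx -[i.+1 == i]negbK neq_ltn ltnSn orbT mulr0 subr0.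
  apply/is_trig_mxP => i j ij; rewrite !mxE -val_eqE /=.
  by rewrite [j == i :> nat]gtn_eqF // [j.+1 == i :> nat]gtn_eqF ?mulr0 ?subr0 // ltnW.
rewrite -[RHS]mulr1 -dW -det_mulmx.
have WE c b : W c b = (c == b)%:R - xvar s * (c.+1 == b :> nat)%:R by rewrite mxE.
have E0 a : (A *m W) a ord0 = A a ord0.
  rewrite mxE (bigD1 ord0) //= WE eqxx mulr0 subr0 mulr1 big1 ?addr0 // => c c0.
  by rewrite WE (negbTE c0) mulr0 subr0 mulr0.
have E1 a b : (A *m W) a (lift ord0 b) = A a (lift ord0 b) - xvar s * A a (widen_ord (leqnSn k) b).
  rewrite mxE; under eq_bigr do rewrite WE mulrBr.
  rewrite sumrB; congr (_ - _).
    rewrite (bigD1 (lift ord0 b)) //= eqxx mulr1 big1 ?addr0 // => c /negbTE ->.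
    by rewrite mulr0.
  rewrite (bigD1 (widen_ord (leqnSn k) b)) //= eqxx mulr1 mulrC big1 ?addr0 // => c cb.
  by rewrite /bump add1n eqSS -[(c == b :> nat)]/(c == widen_ord (leqnSn k) b) (negbTE cb) !mulr0.
rewrite (expand_det_row _ ord0) big_ord_recl E0 big1 => [|b _]; last first.
  by rewrite E1 !mxE /= !hsym1 /bump add1n addnS exprS subrr mul0r.
rewrite addr0 /cofactor expr0 mul1r mxE /= addn0 hsym1; congr (_ * _); congr determinant.
apply/matrixP => a b; rewrite [RHS]mxE [RHS]mxE E1 !mxE /= /bump !add1n addnS.
by rewrite hsymS addrC addKr.
Qed.

(** Only the first row of the enlarged determinant is not symmetric in x_s, ..., x_(s+m). Expanding
    along it, the operators act on powers of x_s alone and raise its flag from 1 to m+1. *)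
Lemma ddiffs_hdet m k s N0 N r : (s + m <= n)%N ->
  (forall a, (a < k)%N -> (m <= r a)%N && (s + r a <= n)%N) ->
  ddiffs (rev (iota s m)) (xvar s ^+ N0 * stair s.+1 m * hdet k s.+1 N r) =
  stair s m * hdet k.+1 s (fcons N0 N) (fcons m.+1 (fun a => (r a).+1)).
Proof.
move=> hs hr; rewrite mulrAC hdet_cons /hdet !(expand_det_row _ ord0).
rewrite mulr_suml ddiffs_sum ?iota_ltn // mulr_sumr; apply: eq_bigr => b _.
rewrite !mxE /= hsym1 mulrAC ddiffsMr ?iota_ltn //.
  rewrite ddiffs_monomial // -mulrA; apply: (congr1 (fun c => _ * (_ * c))).
  rewrite /cofactor; apply: (congr1 (fun D => _ * \det D)).
  by apply/matrixP => i j; rewrite !mxE.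
move=> i; rewrite mem_rev mem_iota => hi.
rewrite /cofactor swapxM swapx_exp swapxN swapx1 swapx_sub_det // => a c.
rewrite !mxE /= add0n; have /andP[h1 h2] : (m <= r a)%N && (s + r a <= n)%N by exact: hr (ltn_ord a).
have [h3 [h4 h5]] : (i < n)%N /\ (s + (r a).+1 <= n.+1)%N /\ (s <= i < s + r a)%N by lia.
by apply: hsym_swap; rewrite ?addnS.
Qed.

End DividedDifferences.

Arguments hsym : simpl never.
#[local] Opaque xvar swapx ddiff.

(** * Divided differences along the words of layered permutations *)

(** Each letter of a decreasing block on top of [m] smaller letters exceeds exactly those among its
    predecessors, hence a run of length [m]. *)
Fixpoint layer_word (s m p : nat) : seq nat :=
  if p is p'.+1 then rev (iota s m) ++ layer_word s.+1 m p' else [::].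

(** The second letter of each pair also exceeds its partner, so its run is longer by one. *)
Fixpoint dlayer_word (s m N : nat) : seq nat :=
  match N with
  | 0 => [::]
  | 1 => rev (iota s m)
  | N'.+2 => rev (iota s m) ++ rev (iota s m.+1) ++ dlayer_word s.+2 m N'
  end.

Lemma nat_ind2 (P : nat -> Prop) :
  P 0%N -> P 1%N -> (forall k, P k -> P k.+2) -> forall k, P k.
Proof.
move=> P0 P1 PS k; suff [] : P k /\ P k.+1 by [].
by elim: k => [|k [IH1 IH2]]; split=> //; apply: PS.
Qed.

Section Words.
Variable n : nat.
Notation xvar := (@xvar n).
Notation ddiffs := (@ddiffs n).
Notation hsym := (@hsym n).
Notation stair := (@stair n).
Notation hdet := (@hdet n).

Lemma layer_word_ltn s m p : all (fun i => (s <= i) && (i.+1 < s + m + p))%N (layer_word s m p).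
Proof.
elim: p s => //= p IH s; rewrite all_cat; apply/andP; split; apply/allP => i.
  by rewrite mem_rev mem_iota; lia.
by move/(allP (IH _)) => /=; lia.
Qed.

Lemma dlayer_word_ltn s m N : all (fun i => (s <= i) && (i.+1 < s + m + N))%N (dlayer_word s m N).
Proof.
elim/nat_ind2: N s => //= [|N IH] s.
  by apply/allP => i; rewrite mem_rev mem_iota; lia.
rewrite !all_cat; apply/and3P; split; apply/allP => i.
- by rewrite mem_rev mem_iota; lia.
- by rewrite mem_rev inE mem_iota; lia.
by move/(allP (IH _)) => /=; lia.
Qed.

Lemma swapx_hdet_out i k s N r : (i < n)%N -> (i.+1 < s)%N ->
  (forall a, (a < k)%N -> (s + r a <= n.+1)%N) ->
  swapx i (hdet k s N r) = hdet k s N r.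
Proof.
move=> hi his hr; apply: swapx_hdet => a b ha.
by apply: hsym_swap_out; rewrite ?his //; have := hr a ha; lia.
Qed.

Lemma ddiffs_layer s m p : (s + m + p <= n.+1)%N ->
  ddiffs (layer_word s m p) (stair s (m + p)) =
  stair s m * hdet p s (fun a => m + p.-1 - a)%N (fun a => m.+1 + a)%N.
Proof.
elim: p s => [|p IH] s hs.
  by rewrite addn0 /hdet det_mx00 mulr1.
have hall := layer_word_ltn s.+1 m p.
rewrite [layer_word _ _ _]/= ddiffs_cat addnS stairS mulrC ddiffsMr; first last.
- by move=> i /(allP hall) /= hi; rewrite swapx_exp swapx_other //; lia.
- by apply/allP => i /(allP hall) /=; lia.
rewrite IH; last by lia.
rewrite mulrC mulrA ddiffs_hdet; [|lia|by move=> a ha; lia].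
by congr (_ * _); apply: eq_hdet => -[|a] ha //=; lia.
Qed.

(** As for [ddiffs_layer], but letters are treated in pairs and add two rows. For odd [N] the
    unpaired last letter produces [hsym_diag], which is 1, and no row. *)
Lemma ddiffs_dlayer s m N : (s + m + N <= n.+1)%N ->
  ddiffs (dlayer_word s m N) (stair s (m + N)) =
  stair s m * hdet N./2.*2 s (fun a => m + N.-2 - a./2.*2)%N (fun a => m.+1 + a)%N.
Proof.
elim/nat_ind2: N s => [s hs|s hs|N IH s hs].
- by rewrite addn0 /hdet det_mx00 mulr1.
- rewrite /= addn1 stairS ddiffs_monomial; last by lia.
  by rewrite hsym_diag /hdet det_mx00.
have hall := dlayer_word_ltn s.+2 m N.
rewrite [dlayer_word _ _ _]/= !ddiffs_cat !addnS !stairS.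
set K := (m + N)%N.
rewrite mulrA mulrC ddiffsMr; first last.
- move=> i /(allP hall) /= hi; rewrite swapxM !swapx_exp.
  by rewrite !swapx_other //; lia.
- by apply/allP => i /(allP hall) /=; lia.
rewrite IH; last by lia.
set D := hdet _ _ _ _.
have hD i : (i <= s)%N -> swapx i D = D.
  by move=> hi; apply: swapx_hdet_out => [||a ha]; lia.
rewrite rev_cons -cats1 ddiffs_cat [ddiffs [:: s] _]/=.
(* The extra letter [s] only lowers x_s^(K+1) x_(s+1)^K to x_s^K x_(s+1)^K, the rest being
   symmetric; hence the two rows of a pair start from the same exponent. *)
have -> : ddiff s (stair s.+2 m * D * (xvar s ^+ K.+1 * xvar s.+1 ^+ K)) =
          xvar s.+1 ^+ K * stair s.+2 m * D * xvar s ^+ K.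
  apply: ddiff_unique; first by lia.
  rewrite !swapxM !swapx_exp swapx_l swapx_r hD // swapx_stair; [|lia..].
  rewrite !exprS; ring.
rewrite ddiffsMr; first last.
- by move=> i; rewrite mem_rev mem_iota => hi; rewrite swapx_exp swapx_other //; lia.
- by apply: iota_ltn; lia.
rewrite ddiffs_hdet; [|lia|by move=> a ha; lia].
rewrite mulrC mulrA ddiffs_hdet; [|lia|by case=> [|a] ha /=; lia].
by congr (_ * _); apply: eq_hdet => -[|[|a]] ha //=; lia.
Qed.

Fixpoint blocks_word (wd : nat -> nat -> seq nat) (m : nat) (bs : seq nat) : seq nat :=
  if bs is p :: bs' then wd m p ++ blocks_word wd (m + p)%N bs' else [::].

Fixpoint blocks_prod (T : comRingType) (F : nat -> nat -> T) (m : nat) (bs : seq nat) : T :=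
  if bs is p :: bs' then F m p * blocks_prod F (m + p)%N bs' else 1.

(** The last block acts first; its factor is symmetric in the variables below it, so all later
    operators leave it alone. *)
Lemma ddiffs_blocks (wd : nat -> nat -> seq nat) (F : nat -> nat -> {mpoly int[n.+1]})
    m (bs : seq nat) :
  (forall m' p, (m <= m')%N -> p \in bs -> (m' + p <= m + sumn bs)%N ->
     all (fun i => i.+1 < m' + p)%N (wd m' p)
     /\ ddiffs (wd m' p) (stair 0 (m' + p)) = stair 0 m' * F m' p) ->
  (forall i m' p, p \in bs -> (i.+1 < m')%N -> (m' + p <= n.+1)%N -> swapx i (F m' p) = F m' p) ->
  (m + sumn bs <= n.+1)%N ->
  ddiffs (blocks_word wd m bs) (stair 0 (m + sumn bs)) = stair 0 m * blocks_prod F m bs.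
Proof.
elim: bs m => [|p bs IH] m /= hwd hF hn; first by rewrite addn0 mulr1.
have [h1 h2] := hwd m p (leqnn _) (mem_head _ _) ltac:(lia).
rewrite ddiffs_cat addnA IH; first last.
- by lia.
- by move=> i m' q qb; apply: hF; rewrite inE qb orbT.
- by move=> m' q hm qb hq; apply: hwd; [lia | rewrite inE qb orbT | lia].
rewrite ddiffsMr ?h2 ?mulrA //.
  by apply/allP => i /(allP h1) /=; lia.
move=> i /(allP h1) /= hi.
have : all (fun q => q \in p :: bs) bs by apply/allP => q qb; rewrite inE qb orbT.
have : (m + p + sumn bs <= n.+1)%N by lia.
have : (i.+1 < m + p)%N by lia.
elim: {-2}bs (m + p)%N => [|q qs IHq] m' hi1 hm' /=; first by rewrite swapx1.
case/andP=> hq hqs; rewrite swapxM hF //; last by move: hm' => /=; lia.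
by rewrite IHq //; move: hm' => /=; lia.
Qed.

End Words.

(** * The Schubert polynomial as a divided difference of the staircase *)

Lemma pairwise_allpairs_fst (T1 T2 : eqType) (R : rel T1) (s1 : seq T1) (s2 : seq T2) :
  reflexive R -> pairwise R s1 ->
  pairwise (fun p q => R p.1 q.1) [seq (x, y) | x <- s1, y <- s2].
Proof.
move=> Rr; elim: s1 => //= x s1 IH /andP[/allP hx hs].
rewrite pairwise_cat IH // andbT; apply/andP; split.
  apply/allrelP => _ _ /mapP[y _ ->] /allpairsP[[z t] [/= zs _ ->]] /=.
  exact: hx.
rewrite pairwise_map; elim: s2 {IH hx} => //= y s2 ->; rewrite andbT.
by apply/allP => z _ /=; exact: Rr.
Qed.

(* [pick] enumerates pairs lexicographically, so it returns the first ascent. *)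
Lemma pick_ord_pair_min n m (P : pred ('I_n * 'I_m)) p :
  [pick x | P x] = Some p -> P p /\ forall q, P q -> (p.1 <= q.1)%N.
Proof.
rewrite /pick.
have : pairwise (fun p q : 'I_n * 'I_m => (p.1 <= q.1)%N) (enum P).
  rewrite {1}/enum_mem unlock /=; apply: pairwise_filter.
  apply: (pairwise_allpairs_fst (R := fun i j : 'I_n => (i <= j)%N)) => //.
  rewrite -(pairwise_map val leq) val_enum_ord.
  by rewrite -sorted_pairwise ?iota_sorted //; exact: leq_trans.
have := mem_enum P; case: (enum P) => //= a s hs /andP[/allP has _] [<-]; split.
  by rewrite -[P a]/(a \in P) -hs mem_head.
by move=> q; rewrite -[P q]/(q \in P) -hs inE => /orP[/eqP -> //|/has].
Qed.

Section Path.
Variable n : nat.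
Notation ddiffs := (@ddiffs n).
Notation stair := (@stair n).
Implicit Types w : 'S_n.+1.

Definition value w (k : nat) : nat := w (inord k).

(** The Lehmer code of non-inversions: earlier positions with a smaller value. *)
Definition cocode w (k : nat) : nat := (\sum_(i < k) (value w i < value w k))%N.

Definition insertion_word (c : nat -> nat) (s : seq nat) : seq nat :=
  flatten [seq rev (iota (k - c k) (c k)) | k <- s].

Lemma staircaseE : staircase n.+1 = stair 0 n.+1.
Proof. by apply: eq_bigr => i _; rewrite xvarE add0n inord_val. Qed.

Lemma noninversionsE w : noninversions w = (\sum_(k < n.+1) cocode w k)%N.
Proof.
rewrite /noninversions -sum1_card.
pose f (i k : 'I_n.+1) : nat := (i < k)%N && (w i < w k)%N.
transitivity (\sum_p f p.1 p.2)%N.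
  by rewrite big_mkcond; apply: eq_bigr => -[i k] _; rewrite inE /f /=; case: ifP.
rewrite -(pair_bigA _ f) exchange_big /=.
apply: eq_bigr => k _.
rewrite /cocode (big_ord_widen n.+1 (fun i => (value w i < value w k : nat)%N)) ?(ltnW (ltn_ord k)) //.
rewrite [RHS]big_mkcond; apply: eq_bigr => i _ /=.
by rewrite /f /value !inord_val; case: (i < k)%N.
Qed.

Lemma ascentE w (i j : 'I_n.+1) : ascent w (i, j) =
  (j == i.+1 :> nat) && (value w i < value w i.+1)%N.
Proof.
rewrite /ascent /value /= inord_val; case: eqP => //= <-.
by rewrite inord_val.
Qed.

Lemma cocode_leq w k : (cocode w k <= k)%N.
Proof.
rewrite /cocode -[X in (_ <= X)%N](card_ord k) -sum1_card.
by apply: leq_sum => i _; case: (_ < _)%N.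
Qed.

Lemma cocode_decreasing w k : (k <= n)%N ->
  (forall i, (i < k)%N -> (value w i.+1 <= value w i)%N) ->
  forall l, (l <= k)%N -> cocode w l = 0%N.
Proof.
move=> hk hdec l hl.
have hlt i d : (i + d <= k)%N -> (value w (i + d) <= value w i)%N.
  elim: d => [|d IH] h; first by rewrite addn0.
  by rewrite addnS (leq_trans (hdec _ _)) ?IH //; lia.
rewrite /cocode big1 // => -[i hi] _ /=.
have := hlt i (l - i)%N; rewrite subnKC; last by lia.
by move=> /(_ hl) => h; rewrite ltnNge h.
Qed.

(** At a first ascent the code of [i] is 0, so the run of [j] loses one letter and moves to position
    [i]: the word of [w] is [i] followed by the word of [w']. *)
Lemma cocode_swap w (i : 'I_n.+1) (j : 'I_n.+1) (w' := (tperm i j * w)%g) :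
  j = i.+1 :> nat -> (value w i < value w j)%N ->
  [/\ (cocode w' i).+1 = cocode w j, cocode w' j = cocode w i &
      forall l, (l <= n)%N -> l != i -> l != j -> cocode w' l = cocode w l].
Proof.
move=> hij hlt.
have vL : value w' i = value w j by rewrite /value /w' permM !inord_val tpermL.
have vR : value w' j = value w i by rewrite /value /w' permM !inord_val tpermR.
have vD l : (l <= n)%N -> l != i -> l != j -> value w' l = value w l.
  by move=> hl li lj; rewrite /value /w' permM tpermD // -val_eqE /= inordK // eq_sym.
have hj := ltn_ord j.
have hD : forall l : 'I_i, value w' l = value w l.
  by move=> [l hl] /=; apply: vD; lia.
split.
- rewrite /cocode hij big_ord_recr /= -hij hlt addn1; congr S.
  by apply: eq_bigr => l _; rewrite hD vL.
- rewrite /cocode hij big_ord_recr /= -hij vR vL ltnNge (ltnW hlt) addn0.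
  by apply: eq_bigr => l _; rewrite hD.
move=> l hl li lj; rewrite /cocode vD //.
have [hli|hli] := ltnP l i.
  by apply: eq_bigr => -[a ha] _ /=; rewrite vD //; lia.
have [d ld] : exists d, l = (i.+2 + d)%N by exists (l - i.+2)%N; lia.
subst l.
rewrite !big_split_ord /=; congr addn; last first.
  by apply: eq_bigr => -[a ha] _ /=; rewrite vD //; lia.
rewrite !big_ord_recr /= -hij vL vR -!addnA; congr addn; last exact: addnC.
by apply: eq_bigr => a _; rewrite hD.
Qed.

Lemma flatten_nil (T : eqType) (ss : seq (seq T)) :
  all (fun s => s == [::]) ss -> flatten ss = [::].
Proof. by elim: ss => //= s ss IH /andP[/eqP -> /IH]. Qed.

Lemma insertion_word_nil (c : nat -> nat) s :
  (forall k, k \in s -> c k = 0%N) -> insertion_word c s = [::].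
Proof. by move=> hc; apply: flatten_nil; rewrite all_map; apply/allP => k /hc /= ->. Qed.

(** Spare fuel is harmless, since the recursion also stops where no ascent is left; this allows an
    inequality in the hypothesis. *)
Lemma schubert_rec_word K w : (\sum_(k < n.+1) cocode w k <= K)%N ->
  schubert_rec K w = ddiffs (insertion_word (cocode w) (iota 0 n.+1)) (staircase n.+1).
Proof.
elim: K w => [|K IH] w hK; rewrite [LHS]/=.
  rewrite insertion_word_nil // => k; rewrite mem_iota add0n => /= hk; apply/eqP.
  by move: hK; rewrite leqn0 sum_nat_eq0 => /forallP /(_ (Ordinal hk)).
case E : [pick p | ascent w p] => [[i j]|]; last first.
  case: pickP E => // hno _.
  rewrite insertion_word_nil // => k; rewrite mem_iota add0n => /= hk.
  apply: (@cocode_decreasing w n) => // i hi.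
  have := hno (inord i, inord i.+1); rewrite ascentE !inordK ?eqxx //=; last by lia.
  by move/negbT; rewrite -leqNgt.
have [] := pick_ord_pair_min E; rewrite ascentE => /andP[/eqP hij hlt] hmin.
have hj : (i.+1 <= n)%N by rewrite -hij -ltnS.
rewrite -hij in hlt.
(* Up to the first ascent [w] decreases. *)
have zero l : (l <= i)%N -> cocode w l = 0%N.
  apply: (@cocode_decreasing w i); first exact: ltnW.
  move=> a ha; rewrite leqNgt; apply/negP => hv.
  have := hmin (inord a, inord a.+1).
  by rewrite ascentE /= !inordK ?eqxx ?hv //=; lia.
have [hi' hj' hother] := cocode_swap hij hlt.
set w' := (tperm i j * w)%g in hi' hj' hother *.
rewrite zero // in hj'.
have range : iota 0 n.+1 = iota 0 i ++ [:: (i : nat); (j : nat)] ++ iota j.+1 (n - j).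
  have nE : n.+1 = (i + (2 + (n - j)))%N by lia.
  by rewrite [X in iota 0 X]nE !iotaD add0n hij addn2.
have word0 : forall c : nat -> nat, (forall l, (l < i)%N -> c l = 0%N) ->
    insertion_word c (iota 0 n.+1) = rev (iota (i - c i) (c i)) ++
      rev (iota (j - c j) (c j)) ++ insertion_word c (iota j.+1 (n - j)).
  move=> c hc; rewrite /insertion_word range map_cat flatten_cat.
  rewrite -/(insertion_word c (iota 0 i)) insertion_word_nil // => k.
  by rewrite mem_iota add0n; exact: hc.
rewrite IH.
  rewrite !word0; first last.
  - by move=> l hl; rewrite hother ?zero //; lia.
  - by move=> l hl; rewrite zero // ltnW.
  have -> : insertion_word (cocode w') (iota j.+1 (n - j)) =
            insertion_word (cocode w) (iota j.+1 (n - j)).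
    rewrite /insertion_word; congr flatten; apply/eq_in_map => k; rewrite mem_iota => hk.
    by rewrite hother //; lia.
  rewrite hj' zero // -hi' /= hij subSS.
  have hc : (cocode w' i <= i)%N by exact: cocode_leq.
  have -> : rev (iota (i - cocode w' i) (cocode w' i).+1) =
            (i : nat) :: rev (iota (i - cocode w' i) (cocode w' i)).
    by rewrite -[(cocode w' i).+1]addn1 iotaD subnK // cats1 rev_rcons.
  by rewrite ddiff_ord //= cats0.
rewrite -ltnS; apply: leq_trans hK.
have ij : j != i by rewrite -val_eqE /= hij gtn_eqF.
rewrite (bigD1 i) //= (bigD1 j) //= [X in (_ <= X)%N](bigD1 i) //=.
rewrite [X in (_ <= _ + X)%N](bigD1 j) //= hj' zero // -hi' add0n addSn ltnS leq_add2l.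
apply: leq_sum => l /andP[li lj]; rewrite hother //.
by rewrite -ltnS.
Qed.

Lemma schubert_word w :
  schubert w = ddiffs (insertion_word (cocode w) (iota 0 n.+1)) (stair 0 n.+1).
Proof. by rewrite -staircaseE /schubert schubert_rec_word // noninversionsE. Qed.

End Path.

(** * Words and evaluations for (doubly) layered permutations *)

Definition list_cocode (s : seq nat) (k : nat) : nat :=
  (\sum_(i < k) (nth 0 s i < nth 0 s k))%N.

Definition list_word (m : nat) (s : seq nat) : seq nat :=
  flatten [seq rev (iota (k - list_cocode s k) (m + list_cocode s k)) | k <- iota 0 (size s)].

Lemma nth_oneline n (w : 'S_n.+1) k : (k <= n)%N -> nth 0%N (oneline w) k = (value w k).+1.
Proof.
move=> hk; rewrite (nth_map ord0) ?size_enum_ord // /value; congr (_ (w _)).+1.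
by apply: val_inj; rewrite /= nth_enum_ord // inordK.
Qed.

Lemma list_word_oneline n (w : 'S_n.+1) :
  insertion_word (cocode w) (iota 0 n.+1) = list_word 0 (oneline w).
Proof.
rewrite /list_word size_map size_enum_ord; congr flatten; apply/eq_in_map => k.
rewrite mem_iota add0n => /= hk.
suff -> : list_cocode (oneline w) k = cocode w k by [].
by apply: eq_bigr => -[i hi] _ /=; rewrite !nth_oneline //; lia.
Qed.

(** Every shifted letter of [v] exceeds all of [u]: its position and its code both grow by [size u],
    so its run starts at the same place and is longer. *)
Lemma list_word_perm_times m u v :
  all (fun x => x <= size u)%N u -> all (leq 1) v ->
  list_word m (perm_times u v) = list_word m u ++ list_word (m + size u) v.
Proof.
move=> hu hv; rewrite /list_word /perm_times size_cat size_map iotaD map_cat flatten_cat.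
congr (flatten _ ++ flatten _).
  apply/eq_in_map => k; rewrite mem_iota => hk.
  suff -> : list_cocode (u ++ [seq (x + size u)%N | x <- v]) k = list_cocode u k by [].
  apply: eq_bigr => -[i hi] _ /=; rewrite !nth_cat !ifT //; lia.
rewrite -[(0 + size u)%N]addn0 add0n iotaDl -map_comp; apply/eq_in_map => k.
rewrite mem_iota => /= hk.
have hk' : (size u + k < size u)%N = false by lia.
have -> : list_cocode (u ++ [seq (x + size u)%N | x <- v]) (size u + k) =
          (size u + list_cocode v k)%N.
  rewrite /list_cocode big_split_ord /=; congr addn.
    rewrite -[RHS](card_ord (size u)) -sum1_card; apply: eq_bigr => i _.
    rewrite !nth_cat ltn_ord hk' addKn (nth_map 0%N) //.
    have := allP hu _ (mem_nth 0%N (ltn_ord i)).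
    have := allP hv _ (mem_nth 0%N hk) => /=.
    by case: ltnP => //; lia.
  apply: eq_bigr => -[i hi] _ /=; rewrite !nth_cat hk' !ifF ?addKn; [|lia].
  by rewrite !(nth_map 0%N) ?ltn_add2r //; lia.
by rewrite subnDl addnA.
Qed.

Lemma list_word_perm_prod (f : nat -> seq nat) m bs :
  (forall p, size (f p) = p) -> (forall p, all (fun x => 0 < x <= p)%N (f p)) ->
  all (leq 1) (perm_prod (map f bs)) /\
  list_word m (perm_prod (map f bs)) = blocks_word (fun m p => list_word m (f p)) m bs.
Proof.
move=> sf hf; elim: bs m => [|p bs IH] m //=.
have hfp := allP (hf p).
split.
  rewrite all_cat; apply/andP; split; first by apply/allP => x /hfp /andP[].
  by rewrite all_map; apply/allP => x hx /=; have := allP (proj1 (IH 0%N)) x hx; rewrite /=; lia.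
rewrite list_word_perm_times ?sf ?(proj2 (IH _)) //; last exact: (proj1 (IH 0%N)).
by apply/allP => x /hfp /andP[].
Qed.

Lemma size_perm_prod (f : nat -> seq nat) bs :
  (forall p, size (f p) = p) -> size (perm_prod (map f bs)) = sumn bs.
Proof. by move=> sf; elim: bs => //= p bs IH; rewrite size_cat size_map IH sf. Qed.

Lemma size_longest p : size (longest p) = p.
Proof. by rewrite size_rev size_iota. Qed.

Lemma longest_bound p : all (fun x => 0 < x <= p)%N (longest p).
Proof. by apply/allP => x; rewrite mem_rev mem_iota; lia. Qed.

Lemma size_tlongest N : size (tlongest N) = N.
Proof. by elim/nat_ind2: N => //= N ->. Qed.

Lemma tlongest_bound N : all (fun x => 0 < x <= N)%N (tlongest N).
Proof.
elim/nat_ind2: N => //= N IH; rewrite ltnS leqnSn leqnn /=.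
by apply: sub_all IH => x; lia.
Qed.

Lemma layer_wordE s m p : layer_word s m p = flatten [seq rev (iota k m) | k <- iota s p].
Proof. by elim: p s => //= p IH s; rewrite IH. Qed.

Lemma dlayer_wordE s m N : ~~ odd s -> dlayer_word s m N =
  flatten [seq rev (iota (k - odd k) (m + odd k)) | k <- iota s N].
Proof.
elim/nat_ind2: N s => [s _|s os|N IH s os] //=.
  by rewrite (negbTE os) subn0 addn0 cats0.
by rewrite (negbTE os) /= subn0 addn0 subn1 addn1 IH //= negbK.
Qed.

Lemma list_word_longest m p : list_word m (longest p) = layer_word 0 m p.
Proof.
rewrite layer_wordE /list_word size_longest; congr flatten; apply/eq_in_map => k.
rewrite mem_iota add0n => /= hk.
suff -> : list_cocode (longest p) k = 0%N by rewrite subn0 addn0.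
apply: big1 => -[i hi] _ /=; rewrite /longest !nth_rev ?size_iota ?nth_iota; [|lia..].
by case: ltnP => //; lia.
Qed.

Lemma list_cocode_tlongest N k : (k < N)%N -> list_cocode (tlongest N) k = odd k.
Proof.
elim/nat_ind2: N k => [|k|N IH k hk] //.
  by rewrite ltnS leqn0 => /eqP ->; rewrite /list_cocode big_ord0.
case: k hk => [|[|k]] hk; rewrite /list_cocode ?big_ord0 //.
  by rewrite big_ord1 /= ltnSn.
rewrite !big_ord_recl /= negbK -(IH k) //.
have := allP (tlongest_bound N) _ (mem_nth 0%N (_ : k < size (tlongest N))%N).
rewrite size_tlongest => /(_ hk) /= hb.
by rewrite ![(_ < nth 0%N (tlongest N) k)%N]ltnNge ![(_ <= _.+1)%N]leqW ?leqW //; lia.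
Qed.

Lemma list_word_tlongest m N : list_word m (tlongest N) = dlayer_word 0 m N.
Proof.
rewrite dlayer_wordE // /list_word size_tlongest; congr flatten; apply/eq_in_map => k.
by rewrite mem_iota add0n => /= hk; rewrite list_cocode_tlongest.
Qed.

Lemma eq_blocks_word (wd wd' : nat -> nat -> seq nat) m bs :
  (forall m p, wd m p = wd' m p) -> blocks_word wd m bs = blocks_word wd' m bs.
Proof. by move=> h; elim: bs m => //= p bs IH m; rewrite h IH. Qed.

Definition layer_poly n (m p : nat) : {mpoly int[n.+1]} :=
  hdet n p 0 (fun a => m + p.-1 - a)%N (fun a => m.+1 + a)%N.

Definition dlayer_poly n (m N : nat) : {mpoly int[n.+1]} :=
  hdet n N./2.*2 0 (fun a => m + N.-2 - a./2.*2)%N (fun a => m.+1 + a)%N.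

Lemma stair00 n : stair n 0 0 = 1.
Proof. exact: big_ord0. Qed.

(** All flags exceed [m], so every row is symmetric in the first [m] variables, as [ddiffs_blocks]
    requires. *)
Lemma swapx_block n i m k (N r : nat -> nat) p : (i.+1 < m)%N -> (m + p <= n.+1)%N ->
  (k <= p)%N -> (forall a, r a = m.+1 + a)%N -> swapx i (hdet n k 0 N r) = hdet n k 0 N r.
Proof.
move=> hi hm hk hr; apply: swapx_hdet => a b ha; rewrite hr.
by apply: hsym_swap; rewrite ?add0n ?leq0n //=; lia.
Qed.

Lemma half_double_leq N : (N./2.*2 <= N)%N.
Proof. by rewrite -[X in (_ <= X)%N](odd_double_half N) leq_addl. Qed.

Lemma schubert_layered n (w : 'S_n.+1) bs : oneline w = perm_prod (map longest bs) ->
  schubert w = blocks_prod (layer_poly n) 0 bs.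
Proof.
move=> hw; have hn : sumn bs = n.+1.
  by rewrite -(size_perm_prod bs size_longest) -hw size_map size_enum_ord.
rewrite schubert_word list_word_oneline hw.
rewrite (proj2 (list_word_perm_prod 0 bs size_longest longest_bound)).
have -> : blocks_word (fun m p => list_word m (longest p)) 0 bs =
          blocks_word (layer_word 0) 0 bs.
  by apply: eq_blocks_word => m p; rewrite list_word_longest.
have -> : stair n 0 n.+1 = stair n 0 (0 + sumn bs) by rewrite hn.
rewrite (@ddiffs_blocks n _ (layer_poly n)) ?stair00 ?mul1r ?hn //.
  move=> m p _ _ hmp; split; first by apply: sub_all (layer_word_ltn 0 m p) => i /andP[].
  exact: ddiffs_layer.
by move=> i m p _ hi hm; apply: swapx_block hi hm _ _.
Qed.

Lemma schubert_doubly_layered n (w : 'S_n.+1) bs :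
  oneline w = perm_prod (map tlongest bs) ->
  schubert w = blocks_prod (dlayer_poly n) 0 bs.
Proof.
move=> hw; have hn : sumn bs = n.+1.
  by rewrite -(size_perm_prod bs size_tlongest) -hw size_map size_enum_ord.
rewrite schubert_word list_word_oneline hw.
rewrite (proj2 (list_word_perm_prod 0 bs size_tlongest tlongest_bound)).
have -> : blocks_word (fun m p => list_word m (tlongest p)) 0 bs =
          blocks_word (dlayer_word 0) 0 bs.
  by apply: eq_blocks_word => m p; rewrite list_word_tlongest.
have -> : stair n 0 n.+1 = stair n 0 (0 + sumn bs) by rewrite hn.
rewrite (@ddiffs_blocks n _ (dlayer_poly n)) ?stair00 ?mul1r ?hn //.
  move=> m p _ _ hmp; split; first by apply: sub_all (dlayer_word_ltn 0 m p) => i /andP[].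
  exact: ddiffs_dlayer.
by move=> i m p _ hi hm; apply: swapx_block hi hm (half_double_leq p) _.
Qed.

Definition layer_value (m p : nat) : int :=
  \det (\matrix_(a < p, b < p) 'C(m + p.-1 - a + b, m + a)%:R).

(** The last row is (0, ..., 0, 1). The smaller form is the one that appears for blocks of odd
    size. *)
Lemma layer_value_trim M q : layer_value M q.+1 =
  \det (\matrix_(a < q, b < q) 'C(M + q - a + b, M + a)%:R).
Proof.
rewrite /layer_value (expand_det_row _ ord_max) big_ord_recr /= big1 => [|b _]; last first.
  by rewrite mxE /= addnK bin_small ?mul0r // ltn_add2l.
rewrite add0r mxE /= addnK binn mul1r /cofactor /= -signr_odd oddD addbb mul1r.
congr (\det _); apply/matrixP => a b; rewrite !mxE !lift_max //.
Qed.

Section ParityBlocks.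
Variable q : nat.

(* The first summand of 'I_q + 'I_q goes onto the numbers of parity c. *)
Definition parity_index (c : bool) (a : 'I_(q + q)) : nat :=
  match split a with inl i => i.*2 + c | inr i => i.*2 + ~~ c end.

Lemma parity_index_ltn c a : (parity_index c a < q + q)%N.
Proof. by rewrite /parity_index; case: split => i; have := ltn_ord i; case: c => /=; lia. Qed.

Definition parity_ord c a : 'I_(q + q) := Ordinal (parity_index_ltn c a).

Lemma parity_ord_inj c : injective (parity_ord c).
Proof.
move=> a b /(congr1 val); rewrite /= /parity_index.
rewrite -{2}[a]splitK -{2}[b]splitK.
case: (split a) => i; case: (split b) => j h.
- by congr (unsplit (inl _)); apply: val_inj => /=; lia.
- by exfalso; case: c h => /= h; lia.
- by exfalso; case: c h => /= h; lia.
- by congr (unsplit (inr _)); apply: val_inj => /=; lia.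
Qed.

(** Sorting the even rows and the columns of parity [c] to the front makes the matrix block
    diagonal; the norm absorbs the signs of the two sortings. *)
Lemma norm_det_parity (c : bool) (B : nat -> nat -> int) :
  (forall a b, odd a (+) odd b != c -> B a b = 0) ->
  `|\det (\matrix_(a < q + q, b < q + q) B a b)| =
  `|\det (\matrix_(i < q, j < q) B i.*2 (j.*2 + c)%N)| *
  `|\det (\matrix_(i < q, j < q) B i.*2.+1 (j.*2 + ~~ c)%N)|.
Proof.
move=> hB; set A := (X in `|\det X| = _).
pose s := perm (@parity_ord_inj false); pose t := perm (@parity_ord_inj c).
have -> : `|\det A| = `|\det (row_perm s (col_perm t A))|.
  by rewrite row_permE col_permE !det_mulmx !det_perm !normrM !normr_sign mulr1 mul1r.
rewrite -normrM -(det_lblock _ (0 : 'M_q)) -[in RHS]det_tr.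
rewrite -[in LHS]det_tr; congr (`|\det _|); congr trmx; apply/matrixP => a b.
rewrite 3!mxE !permE /= /parity_index mxE.
case: splitP => i _; rewrite !mxE; case: splitP => j _; rewrite ?mxE //.
- by rewrite addn0.
- by apply: hB; rewrite !oddD !odd_double; case: (c).
- by apply: hB; rewrite !oddD !odd_double; case: (c).
- by rewrite addn1.
Qed.

End ParityBlocks.

(** * Values of the block determinants at the two evaluation points *)

Section Evaluation.
Variable n : nat.

Lemma meval_hdet (x : 'I_n.+1 -> int) k s N r :
  (hdet n k s N r).@[x] = \det (\matrix_(a < k, b < k) (hsym n s (r a) (N a + b)%N).@[x]).
Proof. by rewrite /hdet -det_map_mx; congr (\det _); apply/matrixP => a b; rewrite !mxE. Qed.

Lemma meval_blocks (x : 'I_n.+1 -> int) (F : nat -> nat -> {mpoly int[n.+1]}) m bs :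
  (blocks_prod F m bs).@[x] = blocks_prod (fun m p => (F m p).@[x]) m bs.
Proof. by elim: bs m => [|p bs IH] m /=; rewrite ?meval1 // mevalM IH. Qed.

Lemma meval_xvar (x : 'I_n.+1 -> int) i : (xvar n i).@[x] = x (inord i).
Proof. by rewrite xvarE mevalXU. Qed.

Lemma hsym_ones s r N : (hsym n s r.+1 N).@[fun=> 1] = 'C(N, r)%:R.
Proof.
elim: r s N => [|r IH] s N.
  by rewrite hsym1 rmorphXn /= meval_xvar expr1n bin0.
elim: N => [|N IHN]; first by rewrite hsym0 /= meval0 bin0n.
by rewrite hsymS mevalD mevalM meval_xvar mul1r IHN IH binS natrD.
Qed.

Definition altpoint (i : 'I_n.+1) : int := (-1) ^+ i.

Lemma meval_xvar_alt i : (i <= n)%N -> (xvar n i).@[altpoint] = (-1) ^+ i.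
Proof. by move=> hi; rewrite meval_xvar /altpoint inordK. Qed.

Lemma hsym_altSS s r N : (s < n)%N -> (hsym n s r.+2 N.+2).@[altpoint] =
  (hsym n s r.+2 N).@[altpoint] + (hsym n s.+2 r N).@[altpoint].
Proof.
move=> hs; rewrite hsymSS mevalD mevalB !mevalM mevalD !meval_xvar_alt //; last exact: ltnW.
have e : (-1 : int) ^+ s * (-1) ^+ s = 1 by rewrite -expr2 sqrr_sign.
by rewrite exprS mulN1r subrr mul0r mulrN e mulN1r sub0r opprK.
Qed.

(** At 2R+2 alternating signs the generating function is (1 - t^2)^-(R+1), so the polynomial of
    degree N - 2R - 1 vanishes unless this degree is even. *)
Lemma hsym_alt s R N : (s + R.*2 < n)%N ->
  (hsym n s R.*2.+2 N).@[altpoint] = if odd N then 'C(N./2, R)%:R else 0.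
Proof.
elim: R s N => [|R IH] s N hs; elim/nat_ind2: N => [||N IHN].
- by rewrite hsym0 meval0.
- by rewrite hsymS !hsym0 !(mevalD, mevalM, meval0, meval1) mulr0 add0r.
- rewrite hsym_altSS; last by lia.
  by rewrite IHN meval0 addr0 /= negbK !bin0.
- by rewrite hsym0 meval0.
- by rewrite hsymS !hsym0 !(mevalD, mevalM, meval0, meval1) mulr0 add0r.
rewrite hsym_altSS ?IHN ?doubleS ?IH; [|lia|lia].
by rewrite /= negbK; case: odd; rewrite ?addr0 // binS natrD.
Qed.

Lemma layer_poly_ones m p : (layer_poly n m p).@[fun=> 1] = layer_value m p.
Proof.
rewrite meval_hdet; congr (\det _); apply/matrixP => a b.
by rewrite !mxE addSn hsym_ones.
Qed.


(* The flags of the rows 2i and 2i+1 are m+2i+1 and m+2i+2: adding to row 2i a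
   multiple of row 2i+1 makes both flags even, and then the entries vanish unless
   the degree is even. *)
Lemma dlayer_poly_alt M N : (M.*2 + N <= n.+1)%N ->
  `|(dlayer_poly n M.*2 N).@[altpoint]| = `|layer_value M N./2| * `|layer_value M (uphalf N)|.
Proof.
move=> hn; set q := N./2.
have hq : (q.*2 <= N)%N by exact: half_double_leq.
pose B a b : int := if odd (N + a + b) then 0 else 'C((M.*2 + N.-1 - a + b)./2, M + a./2)%:R.
pose U : 'M[int]_(q.*2) := \matrix_(a, b) ((a == b)%:R + ((b == a.+1 :> nat) && ~~ odd a)%:R).
have dU : \det U = 1.
  rewrite -det_tr det_trig.
    by rewrite big1 // => i _; rewrite !mxE eqxx -[i == i.+1 :> nat]negbK neq_ltn ltnSn addr0.
  apply/is_trig_mxP => i j ij; rewrite !mxE -val_eqE /=.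
  by rewrite [j == i :> nat]gtn_eqF // [i == j.+1 :> nat]ltn_eqF ?addr0 // ltnS ltnW.
(* The evaluated matrix is [U] times [B]. For r odd the added variable is -1, and [hsymSr] reads
   h(r, K) = h(r+1, K+1) + h(r+1, K): an even row is the sum of two rows of [B]. *)
have -> : (dlayer_poly n M.*2 N).@[altpoint] = \det (\matrix_(a < q + q, b < q + q) B a b).
  rewrite addnn meval_hdet -/q -[RHS]mul1r -dU -det_mulmx; congr (\det _).
  apply/matrixP => a b; rewrite !mxE.
  under eq_bigr do rewrite !mxE mulrDl.
  rewrite big_split /= (bigD1 a) //= eqxx mul1r [X in _ + X + _]big1 ?addr0; last first.
    by move=> c ca; rewrite eq_sym (negbTE ca) mul0r.
  have ha := ltn_ord a.
  pose i := (a : nat)./2.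
  have ai : a = (odd a + i.*2)%N :> nat by rewrite odd_double_half.
  have BE e : (e < q.*2)%N -> B e b = (hsym n 0 (M + e./2).*2.+2 (M.*2 + N.-1 - e + b)).@[altpoint].
    move=> he; have e2 := odd_double_half e; rewrite hsym_alt; last by lia.
    rewrite /B; have -> : odd (M.*2 + N.-1 - e + b) = ~~ odd (N + e + b) by lia.
    by case: odd.
  case oa : (odd a) ai => /= ai.
    rewrite big1 => [|c _]; last by rewrite andbF mul0r.
    rewrite addr0 BE; last by lia.
    rewrite -/i; congr ((hsym _ _ _ _).@[_]); lia.
  have ha1 : (a.+1 < q.*2)%N by lia.
  rewrite (bigD1 (Ordinal ha1)) //= eqxx mul1r big1 => [|c ca]; last first.
    by rewrite -[c == a.+1 :> nat]/(c == Ordinal ha1) (negbTE ca) mul0r.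
  rewrite addr0 !BE; [|lia..].
  set r := (M.*2.+1 + a)%N; set K := (M.*2 + N.-2 - i.*2 + b)%N.
  have h : (hsym n 0 r.+1 K.+1).@[altpoint] =
      - (hsym n 0 r.+1 K).@[altpoint] + (hsym n 0 r K).@[altpoint].
    rewrite hsymSr mevalD mevalM meval_xvar_alt add0n; last by rewrite /r; lia.
    have or : odd r by rewrite /r; lia.
    by rewrite -signr_odd or expr1 mulN1r.
  have -> : (M + (a : nat)./2).*2.+2 = r.+1 by rewrite -/i /r; lia.
  have -> : (M + a.+1./2).*2.+2 = r.+1 by rewrite /r; lia.
  have -> : (M.*2 + N.-1 - a + b)%N = K.+1 by rewrite /K; lia.
  have -> : (M.*2 + N.-1 - a.+1 + b)%N = K by rewrite /K; lia.
  by rewrite h addrAC addNr add0r.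
rewrite (@norm_det_parity q (odd N) B); last first.
  by move=> a b; rewrite /B !oddD -addbA; case: (odd N); case: (_ (+) _).
have NE : N = (odd N + q.*2)%N by rewrite odd_double_half.
have -> : \det (\matrix_(i < q, j < q) B i.*2 (j.*2 + odd N)%N) = layer_value M (uphalf N).
  rewrite uphalf_half -/q; case oN : (odd N) NE => NE; rewrite ?add1n ?add0n.
    (* For [N] odd the block has size q, one less than ceil(N/2); the trimmed row makes up for
       it. *)
    rewrite layer_value_trim; congr (\det _); apply/matrixP => i j; rewrite !mxE /B.
    have hi := ltn_ord i.
    rewrite ifF; last by rewrite !oddD !odd_double oN.
    have -> : (M.*2 + N.-1 - i.*2 + (j.*2 + true))%N = (M + q - i + j).*2.+1 by rewrite /=; lia.
    by rewrite doubleK /= uphalf_double.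
  congr (\det _); apply/matrixP => i j; rewrite !mxE /B; have hi := ltn_ord i.
  rewrite ifF; last by rewrite !oddD !odd_double oN.
  have -> : (M.*2 + N.-1 - i.*2 + (j.*2 + false))%N = (M + q.-1 - i + j).*2.+1 by rewrite /=; lia.
  by rewrite doubleK /= uphalf_double.
have -> : \det (\matrix_(i < q, j < q) B i.*2.+1 (j.*2 + ~~ odd N)%N) = layer_value M q.
  congr (\det _); apply/matrixP => i j; rewrite !mxE /B.
  have hi := ltn_ord i.
  case oN : (odd N) NE => NE.
    rewrite ifF; last by rewrite !oddD /= !odd_double oN.
    have -> : (M.*2 + N.-1 - i.*2.+1 + (j.*2 + ~~ true))%N = (M + q.-1 - i + j).*2.+1 by rewrite /=; lia.
    by rewrite /= !uphalf_double.
  rewrite ifF; last by rewrite !oddD /= !odd_double oN.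
  have -> : (M.*2 + N.-1 - i.*2.+1 + (j.*2 + ~~ false))%N = (M + q.-1 - i + j).*2.+1 by rewrite /=; lia.
  by rewrite /= !uphalf_double.
exact: mulrC.
Qed.

End Evaluation.

(** * The binomial determinant *)

Lemma sum_ord_trunc (V : nmodType) (f : nat -> V) n1 n2 :
  (forall j, (n1 <= j)%N -> f j = 0) -> (forall j, (n2 <= j)%N -> f j = 0) ->
  \sum_(j < n1) f j = \sum_(j < n2) f j.
Proof.
have aux n k : (forall j, (n <= j)%N -> f j = 0) ->
    \sum_(j < n) f j = \sum_(j < n + k) f j.
  move=> h; rewrite big_split_ord /= [X in _ + X]big1 ?addr0 // => j _.
  by apply: h; rewrite leq_addr.
by move=> h1 h2; rewrite (aux _ n2 h1) (aux _ n1 h2) addnC.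
Qed.

(** The Chu-Vandermonde convolution splits off the unitriangular Pascal matrix, which frees the
    upper index of the binomials from the column. *)
Lemma layer_value_binomial m p : layer_value m p =
  \det (\matrix_(a < p, l < p)
    (if (l <= m + a)%N then 'C(m + p.-1 - a, m + a - l)%:R else 0 : int)).
Proof.
set B := (X in _ = \det X).
pose U : 'M[int]_p := \matrix_(l, b) 'C(b, l)%:R.
have dU : \det U = 1.
  rewrite -det_tr det_trig; first by rewrite big1 // => i _; rewrite !mxE binn.
  by apply/is_trig_mxP => i j ij; rewrite !mxE bin_small.
rewrite -[RHS]mulr1 -dU -det_mulmx /layer_value; congr (\det _).
apply/matrixP => a b; rewrite !mxE.
pose f l : int := (if (l <= m + a)%N then 'C(m + p.-1 - a, m + a - l)%:R else 0) * 'C(b, l)%:R.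
transitivity (\sum_(l < p) f l); last by apply: eq_bigr => l _; rewrite !mxE.
rewrite [in 'C(_, _)](addnC _ (b : nat)) -binomial.Vandermonde natr_sum.
rewrite (sum_ord_trunc (n1 := p) (n2 := (m + a).+1)); first last.
- by move=> j hj; rewrite /f leqNgt hj mul0r.
- by move=> j hj; rewrite /f (@bin_small b j) ?mulr0 //; apply: leq_trans hj.
by apply: eq_bigr => -[l hl] _ /=; rewrite /f -ltnS hl natrM mulrC.
Qed.

(* The matrix is a Vandermonde matrix times a matrix that does not depend on [X],
   whose determinant is found at [X = b], where the product is triangular. *)
Lemma det_shifted_products (K : fieldType) p (X : 'I_p -> K) (a b : nat -> K) :
  {in [pred k | k < p]%N &, injective b} ->
  \det (\matrix_(i < p, j < p)
     ((\prod_(k < j) (X i - b k)) * \prod_(t < p.-1 - j) (X i - a t))) =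
  (\prod_(i < p) \prod_(j < p | (i < j)%N) (X j - X i)) *
  \prod_(i < p) \prod_(t < p.-1 - i) (b i - a t).
Proof.
move=> injb.
pose Q j : {poly K} := (\prod_(k < j) ('X - (b k)%:P)) * \prod_(t < p.-1 - j) ('X - (a t)%:P).
have QE j x : (Q j).[x] = (\prod_(k < j) (x - b k)) * \prod_(t < p.-1 - j) (x - a t).
  by rewrite hornerM !horner_prod; congr (_ * _); apply: eq_bigr => k _; rewrite hornerXsubC.
have sizeQ (j : 'I_p) : (size (Q j) <= p)%N.
  apply: leq_trans (size_polyMleq _ _) _.
  rewrite !size_prod_XsubC /index_enum -!enumT !size_enum_ord.
  by have := ltn_ord j; lia.
pose C : 'M[K]_p := \matrix_(l, j) (Q j)`_l.
have factor (Y : 'I_p -> K) : \matrix_(i < p, j < p)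
     ((\prod_(k < j) (Y i - b k)) * \prod_(t < p.-1 - j) (Y i - a t)) =
   (Vandermonde p (\row_i Y i))^T *m C.
  apply/matrixP => i j; rewrite !mxE -QE (horner_coef_wide _ (sizeQ j)).
  by apply: eq_bigr => l _; rewrite !mxE mulrC.
have detV (Y : 'I_p -> K) : \det (Vandermonde p (\row_i Y i))^T =
    \prod_(i < p) \prod_(j < p | (i < j)%N) (Y j - Y i).
  rewrite det_tr det_Vandermonde; apply: eq_bigr => i _; apply: eq_bigr => j _.
  by rewrite !mxE.
rewrite factor det_mulmx detV; congr (_ * _).
have := congr1 determinant (factor (fun i => b i)).
rewrite det_mulmx detV [X in X = _]det_trig; last first.
  apply/is_trig_mxP => i j ij; rewrite mxE (bigD1 (Ordinal ij)) //= subrr mul0r.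
  by rewrite mul0r.
under [X in X = _]eq_bigr do rewrite mxE.
rewrite big_split /=.
have -> : \prod_(i < p) \prod_(k < i) (b i - b k) =
          \prod_(i < p) \prod_(j < p | (i < j)%N) (b j - b i).
  rewrite (exchange_big_dep xpredT) //=; apply: eq_bigr => i _.
  by rewrite (big_ord_widen p (fun k => b i - b k)) // ltnW.
move/mulfI => -> //.
apply/prodf_neq0 => i _; apply/prodf_neq0 => j ij.
rewrite subr_eq0; apply/eqP => /injb; rewrite !inE => /(_ (ltn_ord j) (ltn_ord i)) ji.
by rewrite ji ltnn in ij.
Qed.

(** The normalisation that determines the constant in [layer_value_prop]. *)
Lemma layer_value0 p : layer_value 0 p = 1.
Proof.
rewrite layer_value_binomial det_trig.
  by rewrite big1 // => i _; rewrite mxE leqnn subnn bin0.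
by apply/is_trig_mxP => i j ij; rewrite mxE add0n leqNgt ij.
Qed.

(** Up to factors depending on the row only, an entry is a product of two falling factorials, of
    total degree p-1 in [a]: the shape needed by [det_shifted_products]. Outside the range of the
    binomial a falling factorial vanishes too. *)
Lemma layer_entry m p a l : (a < p)%N -> (l < p)%N ->
  ((if l <= m + a then 'C(m + p.-1 - a, m + a - l) else 0) *
     ((m + a)`! * (2 * (p.-1 - a))`!) =
   (m + p.-1 - a)`! * ((m + a) ^_ l * (2 * (p.-1 - a)) ^_ (p.-1 - l)))%N.
Proof.
move=> ha hl; case: ifP => hla; last first.
  by rewrite (@ffact_small (m + a)) ?mul0n ?muln0 //; lia.
have [h|h] := leqP (p.-1 - l) (2 * (p.-1 - a)); last first.
  by rewrite bin_small ?(@ffact_small (2 * _)) ?muln0 //; lia.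
rewrite -(ffact_fact hla) -(ffact_fact h).
rewrite -(@bin_fact (m + p.-1 - a) (m + a - l)); last by lia.
have -> : (m + p.-1 - a - (m + a - l) = 2 * (p.-1 - a) - (p.-1 - l))%N by lia.
set A := 'C(_, _); set B := (_ ^_ _)%N; set C := (_ `!)%N.
set D := (_ ^_ _)%N; set E := (_ `!)%N.
by rewrite -!mulnA; congr muln; lia.
Qed.

(** * The product formula for the determinant *)

Section LayerFactor.
Variable R : numFieldType.

Lemma natr_ffact n k : (n ^_ k)%:R = \prod_(i < k) (n%:R - i%:R) :> R.
Proof.
elim: k => [|k IH]; first by rewrite big_ord0.
rewrite ffactnSr natrM IH big_ord_recr /=.
have [h|h] := leqP k n; first by rewrite natrB.
have -> : \prod_(i < k) (n%:R - i%:R) = 0 :> R; last by rewrite !mul0r.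
by rewrite -IH ffact_small.
Qed.

Lemma rev_prod p (f : nat -> R) : \prod_(i < p) f (p.-1 - i)%N = \prod_(i < p) f i.
Proof.
rewrite (reindex_inj rev_ord_inj) /=; apply: eq_bigr => -[i hi] _ /=.
by congr f; lia.
Qed.

Definition layer_factor (m p : nat) : R :=
  \prod_(j < p) \prod_(i < j) ((2 * m + (i + j).+1)%:R / (i + j).+1%:R).

Lemma layer_value_prop p : exists c : R, forall m,
  (layer_value m p)%:~R = c * \prod_(j < p) \prod_(i < j) (2 * m + (i + j).+1)%:R.
Proof.
pose W : R := \prod_(a < p) ((2 * (p.-1 - a))`!%:R)^-1.
pose V : R := \prod_(i < p) \prod_(j < p | (i < j)%N) (j%:R - i%:R).
pose S : R := \prod_(l < p) (-2) ^+ (p.-1 - l).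
pose H : R := \prod_(j < p) \prod_(i < j) (- 2^-1).
exists (W * (V * H) * S) => m.
pose w a : R := (m + p.-1 - a)`!%:R / ((m + a)`!%:R * (2 * (p.-1 - a))`!%:R).
(* [b] and [t'] list the roots, in the variable a, of the two falling factorials: m+a-k = a - b_k
   and 2(p-1-a) - k = -2 (a - t'_k). *)
pose b k : R := k%:R - m%:R.
pose t' k : R := p.-1%:R - k%:R / 2.
pose M := \matrix_(i < p, j < p)
     ((\prod_(k < j) ((i : nat)%:R - b k)) * \prod_(t < p.-1 - j) ((i : nat)%:R - t' t)).
have -> : (layer_value m p)%:~R =
  \det (diag_mx (\row_a w a) *m M *m diag_mx (\row_(l < p) (-2) ^+ (p.-1 - l))).
  rewrite layer_value_binomial -[LHS]det_map_mx; congr (\det _).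
  apply/matrixP => a l; rewrite mul_mx_diag mul_diag_mx !mxE.
  have := layer_entry m (ltn_ord a) (ltn_ord l).
  move/(congr1 (fun k : nat => k%:R : R)); rewrite !natrM !natr_ffact => he.
  have -> : \prod_(k < l) ((a : nat)%:R - b k) = \prod_(i < l) ((m + a)%:R - i%:R).
    by apply: eq_bigr => i _; rewrite /b natrD; ring.
  have e2 : \prod_(i < p.-1 - l) ((2 * (p.-1 - a))%:R - i%:R) =
     (-2) ^+ (p.-1 - l) * \prod_(t < p.-1 - l) ((a : nat)%:R - t' t) :> R.
    rewrite -[X in _ ^+ X]card_ord -prodr_const -big_split /=.
    apply: eq_bigr => i _; rewrite /t' natrM natrB; last by have := ltn_ord a; lia.
    by field.
  rewrite e2 in he.
  have n1 : (m + a)`!%:R != 0 :> R by rewrite pnatr_eq0 -lt0n fact_gt0.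
  have n2 : (2 * (p.-1 - a))`!%:R != 0 :> R by rewrite pnatr_eq0 -lt0n fact_gt0.
  apply: (mulIf (mulf_neq0 n1 n2)).
  transitivity ((if (l <= m + a)%N then 'C(m + p.-1 - a, m + a - l) else 0%N)%:R *
     ((m + a)`!%:R * (2 * (p.-1 - a))`!%:R) : R).
    by congr (_ * _); case: ifP => _; rewrite ?rmorph_nat ?rmorph0.
  rewrite he /w; field.
  by rewrite n1 n2.
rewrite !det_mulmx !det_diag det_shifted_products; last first.
  move=> i j _ _ /(congr1 (fun x => x + m%:R)); rewrite /b !subrK => /eqP.
  by rewrite eqr_nat => /eqP.
rewrite -/V.
have -> : \prod_(i < p) (\row_(a < p) w a) 0 i = W.
  transitivity (\prod_(a < p) ((m + p.-1 - a)`!%:R / (m + a)`!%:R * ((2 * (p.-1 - a))`!%:R)^-1) : R).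
    by apply: eq_bigr => a _; rewrite mxE /w invfM mulrA.
  rewrite big_split /= -[RHS]mul1r; congr (_ * _).
  rewrite big_split /= prodfV.
  (* Reversing the rows cancels all factorials that depend on [m]. *)
  have -> : \prod_(a < p) (m + p.-1 - a)`!%:R = \prod_(a < p) (m + a)`!%:R :> R.
    rewrite -[RHS](rev_prod p (fun a => (m + a)`!%:R)); apply: eq_bigr => -[a ha] _ /=.
    by rewrite addnBA //; lia.
  by rewrite divff //; apply/prodf_neq0 => a _; rewrite pnatr_eq0 -lt0n fact_gt0.
have -> : \prod_(i < p) (\row_(l < p) (-2) ^+ (p.-1 - l)) 0 i = S.
  by apply: eq_bigr => l _; rewrite mxE.
(* b_i - t'_t = -(2m + 2(p-1-i) - t)/2; reversing both indices gives 2m+i+j+1. *)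
have -> : \prod_(i < p) \prod_(t < p.-1 - i) (b i - t' t) =
   H * \prod_(j < p) \prod_(i < j) (2 * m + (i + j).+1)%:R.
  rewrite -big_split /=.
  pose f j i : R := - 2^-1 * (2 * m + (i + j).+1)%:R.
  transitivity (\prod_(j < p) \prod_(i < j) f j i); last first.
    by apply: eq_bigr => j _; rewrite -big_split.
  rewrite -[RHS](rev_prod p (fun j => \prod_(i < j) f j i)); apply: eq_bigr => -[i hi] _ /=.
  rewrite -[RHS](rev_prod _ (f _)); apply: eq_bigr => -[t ht] _ /=.
  rewrite /f; have -> : (2 * m + ((p.-1 - i).-1 - t + (p.-1 - i)).+1 = 2 * m + 2 * (p.-1 - i) - t)%N by lia.
  rewrite /b /t' natrB; last by lia.
  by rewrite !(natrD, natrM) natrB; [field | lia].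
ring.
Qed.

Lemma layer_valueE m p : (layer_value m p)%:~R = layer_factor m p.
Proof.
have [c hc] := layer_value_prop p.
rewrite hc; have := hc 0%N; rewrite layer_value0 => h0.
set P : R := (\prod_(j < p) \prod_(i < j) (2 * m + (i + j).+1)%:R).
have -> : layer_factor m p = P / \prod_(j < p) \prod_(i < j) (2 * 0 + (i + j).+1)%:R.
  rewrite -prodfV -big_split; apply: eq_bigr => j _ /=.
  by rewrite -prodfV -big_split; apply: eq_bigr => i _ /=; rewrite muln0 add0n.
have D0 : \prod_(j < p) \prod_(i < j) (2 * 0 + (i + j).+1)%:R != 0 :> R.
  by apply/prodf_neq0 => j _; apply/prodf_neq0 => i _; rewrite pnatr_eq0.
by apply: (mulIf D0); rewrite mulfVK // mulrAC -h0 mul1r.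
Qed.
End LayerFactor.

(** * The maxima v and vtilde *)

Lemma oneline_surjective n s : size s = n.+1 -> uniq s ->
  all (fun x => 0 < x <= n.+1)%N s -> exists w : 'S_n.+1, oneline w = s.
Proof.
move=> ss us /allP hs.
have hin (i : 'I_n.+1) : (0 < nth 0%N s i <= n.+1)%N by apply: hs; rewrite mem_nth ?ss.
pose f (i : 'I_n.+1) : 'I_n.+1 := inord (nth 0%N s i).-1.
have fE i : (f i).+1 = nth 0%N s i.
  by have /andP[h1 h2] := hin i; rewrite /f inordK prednK.
have finj : injective f.
  move=> i j /(congr1 (fun k : 'I_n.+1 => k.+1)); rewrite !fE => /eqP.
  by rewrite nth_uniq ?ss // => /eqP /val_inj.
exists (perm finj); apply: (@eq_from_nth _ 0%N).
  by rewrite size_map size_enum_ord ss.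
move=> i; rewrite size_map size_enum_ord => hi.
by rewrite nth_oneline // /value permE fE inordK.
Qed.

Lemma perm_prod_bound (f : nat -> seq nat) bs :
  (forall p, size (f p) = p) -> (forall p, all (fun x => 0 < x <= p)%N (f p)) ->
  all (fun x => 0 < x <= sumn bs)%N (perm_prod (map f bs)).
Proof.
move=> sf hf; elim: bs => //= p bs IH; rewrite all_cat; apply/andP; split.
  by apply: sub_all (hf p) => x; lia.
by rewrite all_map; apply: sub_all IH => x /=; rewrite sf; lia.
Qed.

Lemma perm_prod_uniq (f : nat -> seq nat) bs :
  (forall p, size (f p) = p) -> (forall p, all (fun x => 0 < x <= p)%N (f p)) ->
  (forall p, uniq (f p)) -> uniq (perm_prod (map f bs)).
Proof.
move=> sf hf uf; elim: bs => //= p bs IH; rewrite cat_uniq uf map_inj_uniq ?IH.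
  rewrite andbT /=; apply/hasPn => _ /mapP[x hx ->]; apply/negP => /(allP (hf p)).
  by have := allP (perm_prod_bound bs sf hf) x hx; rewrite /= sf; lia.
exact: addIn.
Qed.

Lemma longest_uniq p : uniq (longest p).
Proof. by rewrite rev_uniq iota_uniq. Qed.

Lemma tlongest_uniq N : uniq (tlongest N).
Proof.
elim/nat_ind2: N => //= N ->; rewrite andbT inE negb_or.
have h k : (N < k)%N -> k \notin tlongest N.
  by move=> hk; apply/negP => /(allP (tlongest_bound N)) /=; lia.
by rewrite !h ?andbT ?ltn_eqF // ltnW.
Qed.

Lemma blocks_exist (f : nat -> seq nat) n bs :
  (forall p, size (f p) = p) -> (forall p, all (fun x => 0 < x <= p)%N (f p)) ->
  (forall p, uniq (f p)) -> sumn bs = n.+1 ->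
  exists w : 'S_n.+1, oneline w = perm_prod (map f bs).
Proof.
move=> sf hf uf hn; apply: oneline_surjective.
- by rewrite size_perm_prod.
- exact: perm_prod_uniq.
by rewrite -hn; exact: perm_prod_bound.
Qed.

Lemma bigmax_cases (I : finType) (P : pred I) (F : I -> int) :
  \big[Num.max/0]_(i | P i) F i = 0 \/
  exists2 i, P i & \big[Num.max/0]_(i | P i) F i = F i.
Proof.
elim/big_ind: _ => [|x y IHx IHy|i Pi]; [by left| |by right; exists i].
by rewrite /Num.max; case: ifP.
Qed.

Section Values.
Variable R : realType.
Notation lf := (layer_factor R).

Definition comp_value (m : nat) (bs : seq nat) : R := blocks_prod lf m bs.

Lemma blocks_prod_rcons (T : comRingType) (F : nat -> nat -> T) m bs p :
  blocks_prod F m (rcons bs p) = blocks_prod F m bs * F (m + sumn bs)%N p.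
Proof.
elim: bs m => [|q bs IH] m /=; first by rewrite addn0 mulr1 mul1r.
by rewrite IH mulrA addnA.
Qed.

Lemma layer_factor_ge1 m p : 1 <= lf m p.
Proof.
apply: (big_ind (fun x : R => 1 <= x)) => // [x y hx hy|j _]; first exact: mulr_ege1.
apply: (big_ind (fun x : R => 1 <= x)) => // [x y hx hy|i _]; first exact: mulr_ege1.
by rewrite ler_pdivlMr ?ltr0n // mul1r ler_nat leq_addl.
Qed.

Lemma layer_factor_gt0 m p : 0 < lf m p.
Proof. exact: lt_le_trans (layer_factor_ge1 m p). Qed.

Lemma comp_value_ge1 m bs : 1 <= comp_value m bs.
Proof.
elim: bs m => [|p bs IH] m //=; apply: mulr_ege1; [exact: layer_factor_ge1 | exact: IH].
Qed.

Lemma schubert_at_ones_layered n (w : 'S_n.+1) bs :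
  oneline w = perm_prod (map longest bs) -> (schubert_at_ones w)%:~R = comp_value 0 bs.
Proof.
move=> hw; rewrite /schubert_at_ones (schubert_layered hw) meval_blocks /comp_value.
elim: bs 0%N {hw} => [|p bs IH] m //=; rewrite intrM IH.
by rewrite layer_poly_ones /= layer_valueE.
Qed.

(** All blocks but the last have even size, so every block starts at an even offset and
    [dlayer_poly_alt] applies; a block of size 2p gives a square. *)
Lemma Phi_doubly_layered n (w : 'S_n.+1) b N :
  oneline w = perm_prod (map tlongest (rcons (map double b) N)) ->
  (Phi w)%:~R = comp_value 0 b ^+ 2 * (lf (sumn b) N./2 * lf (sumn b) (uphalf N)).
Proof.
move=> hw; have hn : sumn (rcons (map double b) N) = n.+1.
  by rewrite -(size_perm_prod _ size_tlongest) -hw size_map size_enum_ord.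
rewrite /Phi (schubert_doubly_layered hw) meval_blocks.
have norm_value m p : (`|layer_value m p|)%:~R = lf m p.
  by rewrite intr_norm layer_valueE ger0_norm // ltW // layer_factor_gt0.
suff aux m : (m.*2 + sumn (rcons (map double b) N) = n.+1)%N ->
    `|blocks_prod (fun m' p => (dlayer_poly n m' p).@[@altpoint n]) m.*2
       (rcons (map double b) N)|%:~R =
    blocks_prod lf m b ^+ 2 * (lf (m + sumn b) N./2 * lf (m + sumn b) (uphalf N)).
  exact: (aux 0%N).
elim: b m {hw hn} => [|p b IH] m /= hn.
  rewrite expr1n mul1r mulr1 addn0 dlayer_poly_alt ?intrM ?norm_value //; last by lia.
rewrite normrM intrM -doubleD IH; last by lia.
rewrite dlayer_poly_alt; last by lia.
by rewrite doubleK uphalf_double intrM norm_value addnA; ring.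
Qed.

Lemma v_ge n bs : all (leq 1) bs -> sumn bs = n.+1 -> comp_value 0 bs <= (v n.+1)%:~R.
Proof.
move=> hb hn; have [w hw] := blocks_exist size_longest longest_bound longest_uniq hn.
rewrite -(schubert_at_ones_layered hw) ler_int /v.
apply: le_bigmax_cond; apply/asboolP.
by exists bs.
Qed.

Lemma v_attained n : exists bs, [/\ all (leq 1) bs, sumn bs = n.+1 &
  (v n.+1)%:~R = comp_value 0 bs].
Proof.
have [h|[w /asboolP[bs [hb hs hw]] hv]] := bigmax_cases
    (fun w : 'S_n.+1 => `[< layered w >]) (fun w => schubert_at_ones w).
  (* The default 0 is not the maximum: the composition into ones already has value at least 1. *)
  have h1 : all (leq 1) (nseq n.+1 1%N) by rewrite all_nseq orbT.
  have h2 : sumn (nseq n.+1 1%N) = n.+1 by rewrite sumn_nseq mul1n.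
  have := v_ge h1 h2; rewrite /v h.
  by move/(le_trans (comp_value_ge1 _ _)); rewrite rmorph0 ler10.
by exists bs; split=> //; rewrite /v hv (schubert_at_ones_layered hw).
Qed.

Definition dcomp_value (b : seq nat) (bk r : nat) : R :=
  comp_value 0 b ^+ 2 * (lf (sumn b) bk * lf (sumn b) (bk + r)).

Lemma double_half_odd k (r : bool) :
  ((k.*2 + r)./2 = k)%N /\ (uphalf (k.*2 + r) = k + r)%N.
Proof. by case: r; rewrite ?addn1 ?addn0 /= ?uphalf_double ?doubleK. Qed.

Lemma sumn_double b : sumn (map double b) = (sumn b).*2.
Proof. by elim: b => //= p b ->; rewrite doubleD. Qed.

Lemma vtilde_ge n b bk : all (leq 1) (rcons b bk) ->
  ((sumn b + bk).*2 + odd n.+1 = n.+1)%N -> dcomp_value b bk (odd n.+1) <= (vtilde n.+1)%:~R.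
Proof.
move=> hb hn.
have hs : sumn (rcons (map double b) (bk.*2 + odd n.+1)%N) = n.+1.
  by rewrite sumn_rcons sumn_double -[RHS]hn doubleD addnA.
have [w hw] := blocks_exist size_tlongest tlongest_bound tlongest_uniq hs.
have [e1 e2] := double_half_odd bk (odd n.+1).
have := Phi_doubly_layered hw; rewrite e1 e2 -/(dcomp_value _ _ _) => <-.
rewrite ler_int /vtilde.
apply: le_bigmax_cond; apply/asboolP.
by exists b, bk.
Qed.

Lemma vtilde_attained n : (0 < n)%N -> exists b bk, [/\ all (leq 1) (rcons b bk),
  ((sumn b + bk).*2 + odd n.+1 = n.+1)%N & (vtilde n.+1)%:~R = dcomp_value b bk (odd n.+1)].
Proof.
move=> n0.
have [h|[w /asboolP[b [bk [hb hs hw]]] hv]] := bigmax_cases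
    (fun w : 'S_n.+1 => `[< doubly_layered w >]) (fun w => Phi w).
  have hb : all (leq 1) (rcons [::] n.+1./2) by case: (n) n0.
  have hn : ((sumn [::] + n.+1./2).*2 + odd n.+1 = n.+1)%N by rewrite addnC odd_double_half.
  have := vtilde_ge hb hn; rewrite /vtilde h rmorph0 /dcomp_value expr1n mul1r.
  by rewrite leNgt mulr_gt0 ?layer_factor_gt0.
exists b, bk; split=> //.
  by rewrite -[RHS]hs sumn_rcons sumn_double doubleD addnA.
have [e1 e2] := double_half_odd bk (odd n.+1).
by rewrite /vtilde hv (Phi_doubly_layered hw) e1 e2.
Qed.

End Values.

(** * Growth of v and its comparison with vtilde *)

Section Growth.
Variable R : realType.
Notation lf := (layer_factor R).
Notation cv := (comp_value R 0).
Notation vR n := ((v n)%:~R : R).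
Notation vtR n := ((vtilde n)%:~R : R).

Lemma layer_factorS m p :
  lf m p.+1 = lf m p * \prod_(i < p) ((2 * m + (i + p).+1)%:R / (i + p).+1%:R).
Proof. by rewrite /layer_factor big_ord_recr. Qed.

Lemma layer_factor1 m : lf m 1 = 1.
Proof. by rewrite /layer_factor big_ord1 big_ord0. Qed.

Lemma prod_ratio_ge1 m s k : 1 <= \prod_(i < k) ((2 * m + (i + s).+1)%:R / (i + s).+1%:R) :> R.
Proof.
apply: (big_ind (fun x : R => 1 <= x)) => // [x y hx hy|i _]; first exact: mulr_ege1.
by rewrite ler_pdivlMr ?ltr0n // mul1r ler_nat leq_addl.
Qed.

Lemma layer_factor_le m p q : (p <= q)%N -> lf m p <= lf m q.
Proof.
move=> pq; rewrite -(subnKC pq); elim: (q - p)%N => [|d IH]; first by rewrite addn0.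
rewrite addnS layer_factorS; apply: le_trans IH _.
by rewrite ler_peMr ?prod_ratio_ge1 // ltW // layer_factor_gt0.
Qed.

Lemma comp_value_rcons bs p : cv (rcons bs p) = cv bs * lf (sumn bs) p.
Proof. exact: blocks_prod_rcons. Qed.

Lemma v_step m p : (0 < m)%N -> (0 < p)%N -> vR m * lf m p <= vR (m + p)%N.
Proof.
case: m => // m _ p0; have [bs [hb hs ->]] := v_attained R m.
rewrite -{1}hs -comp_value_rcons addSn; apply: v_ge; first by rewrite all_rcons p0.
by rewrite sumn_rcons hs addSn.
Qed.

Lemma v_leS n : (0 < n)%N -> vR n <= vR n.+1.
Proof. by move=> n0; rewrite -addn1; have := v_step n0 (ltn0Sn 0); rewrite layer_factor1 mulr1. Qed.

Lemma v_ge1 n : (0 < n)%N -> 1 <= vR n.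
Proof. by case: n => // n _; have [bs [_ _ ->]] := v_attained R n; exact: comp_value_ge1. Qed.

(** Doubling is a bijection between compositions; only the last block can differ between its two
    factors, by one letter, and [layer_factor_le] absorbs this in either direction. *)
Lemma square_vtilde n : (1 < n)%N -> vR n./2 ^+ 2 <= vtR n <= vR (uphalf n) ^+ 2.
Proof.
case: n => // n n0; apply/andP; split.
  have n2 : n.+1./2 = n.+1./2.-1.+1 by case: (n) n0.
  rewrite n2; have [bs] := v_attained R n.+1./2.-1; rewrite -n2.
  case/lastP: bs => [|b bk] [hb hs ->]; first by move: hs n0; rewrite n2.
  have hn : ((sumn b + bk).*2 + odd n.+1 = n.+1)%N.
    by rewrite -sumn_rcons hs addnC odd_double_half.
  apply: le_trans (vtilde_ge R hb hn); rewrite /dcomp_value comp_value_rcons exprMn.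
  rewrite ler_wpM2l ?sqr_ge0 // expr2 ler_wpM2l ?layer_factor_le ?leq_addr //.
  by rewrite ltW // layer_factor_gt0.
have [b [bk [hb hn ->]]] := vtilde_attained R n0.
have hu : uphalf n.+1 = (sumn b + (bk + odd n.+1))%N.
  by rewrite -[in LHS]hn addnA; have [_ ->] := double_half_odd (sumn b + bk) (odd n.+1).
move: hb; rewrite all_rcons => /andP[hbk hb].
have : vR (uphalf n.+1) >= cv (rcons b (bk + odd n.+1)).
  have -> : uphalf n.+1 = (uphalf n.+1).-1.+1 by [].
  apply: v_ge; rewrite ?all_rcons ?sumn_rcons -?hu // hb andbT.
  exact: leq_trans hbk (leq_addr _ _).
rewrite comp_value_rcons => hv; rewrite /dcomp_value.
apply: (@le_trans _ _ ((cv b * lf (sumn b) (bk + odd n.+1)) ^+ 2)).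
  rewrite exprMn ler_wpM2l ?sqr_ge0 // expr2 ler_wpM2r ?layer_factor_le ?leq_addr //.
  by rewrite ltW // layer_factor_gt0.
rewrite lerXn2r // nnegrE; last by apply: le_trans (v_ge1 _) => //; case: (n) n0.
by rewrite mulr_ge0 // ltW ?layer_factor_gt0 // (lt_le_trans _ (comp_value_ge1 _ _ _)).
Qed.

Lemma prod_blocks (f : nat -> R) k p :
  \prod_(i < k * p) f i = \prod_(j < p) \prod_(b < k) f (k * j + b)%N.
Proof.
elim: p => [|p IH]; first by rewrite muln0 !big_ord0.
by rewrite mulnSr big_split_ord IH big_ord_recr.
Qed.

Definition shift_ratio (m c : nat) : R := (2 * m + c)%:R / c%:R.

Lemma shift_ratio_ge1 m c : (0 < c)%N -> 1 <= shift_ratio m c.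
Proof. by move=> c0; rewrite /shift_ratio ler_pdivlMr ?ltr0n // mul1r ler_nat leq_addl. Qed.

Lemma shift_ratio_ge0 m c : 0 <= shift_ratio m c.
Proof. by rewrite divr_ge0. Qed.

(* Log-convexity of c |-> (2 m + c) / c. *)
Lemma shift_ratio_pair m k c u u' : (0 < k)%N -> (0 < u)%N -> (0 < u')%N ->
  (u + u' = 2 * (k * c))%N -> shift_ratio m c ^+ 2 <= shift_ratio (k * m) u * shift_ratio (k * m) u'.
Proof.
move=> k0 u0 u'0 huu.
have c0 : (0 < c)%N by nia.
have hk : 0 < k%:R :> R by rewrite ltr0n.
have hc : 0 < c%:R :> R by rewrite ltr0n.
have hu : 0 < u%:R :> R by rewrite ltr0n.
have hu' : 0 < u'%:R :> R by rewrite ltr0n.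
have hm : 0 <= m%:R :> R by [].
have hs : u%:R + u'%:R = 2 * (k%:R * c%:R) :> R by rewrite -natrD huu !natrM.
have -> : shift_ratio m c = (2 * (k%:R * m%:R) + k%:R * c%:R) / (k%:R * c%:R).
  by rewrite /shift_ratio natrD natrM; field; rewrite !gt_eqF.
have rE x : (2 * (k * m) + x)%:R = 2 * (k%:R * m%:R) + x%:R :> R by rewrite natrD 2!natrM.
rewrite /shift_ratio !rE.
move: (k%:R * m%:R) (k%:R * c%:R) (mulr_ge0 (ltW hk) hm) (mulr_gt0 hk hc) hs {rE} => M C hM hC hs.
have hC2 : C = (u%:R + u'%:R) / 2 by rewrite hs; field.
have huC : u%:R * u'%:R <= C ^+ 2.
  rewrite hC2 -subr_ge0.
  have -> : ((u%:R + u'%:R) / 2) ^+ 2 - u%:R * u'%:R = ((u%:R - u'%:R) / 2) ^+ 2 :> R by field.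
  exact: sqr_ge0.
have -> : (2 * M + u%:R) / u%:R * ((2 * M + u'%:R) / u'%:R) =
   1 + (2 * M * (2 * M + 2 * C)) / (u%:R * u'%:R).
  by rewrite -hs; field; rewrite !gt_eqF.
have -> : ((2 * M + C) / C) ^+ 2 = 1 + (2 * M * (2 * M + 2 * C)) / C ^+ 2.
  by field; rewrite gt_eqF.
rewrite lerD2l ler_wpM2l //; first by rewrite mulr_ge0 ?addr_ge0 ?mulr_ge0 // ltW.
by rewrite lef_pV2 ?posrE ?exprn_gt0 ?mulr_gt0.
Qed.

(** Pairing (a, b) with (k-1-a, k-1-b) makes the two arguments average to k(s+1), where
    [shift_ratio_pair] applies; hence the squaring of both sides. *)
Lemma shift_ratio_block m k s : (0 < k)%N -> shift_ratio m s.+1 ^+ (k ^ 2) <=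
  \prod_(b < k) \prod_(a < k) shift_ratio (k * m) (k * s + a + b).+1.
Proof.
move=> k0.
set X := (X in _ <= X).
have X0 : 0 <= X by apply: prodr_ge0 => b _; apply: prodr_ge0 => a _; exact: shift_ratio_ge0.
rewrite -(@ler_pXn2r _ 2) ?nnegrE ?exprn_ge0 ?shift_ratio_ge0 //.
have -> : (shift_ratio m s.+1 ^+ (k ^ 2)) ^+ 2 = \prod_(b < k) \prod_(a < k) shift_ratio m s.+1 ^+ 2.
  rewrite prodr_const card_ord prodr_const card_ord -!exprM; congr (_ ^+ _); lia.
have -> : X ^+ 2 = \prod_(b < k) \prod_(a < k)
   (shift_ratio (k * m) (k * s + a + b).+1 *
    shift_ratio (k * m) (k * s + (k.-1 - a) + (k.-1 - b)).+1).
  rewrite expr2; under [RHS]eq_bigr do rewrite big_split /=.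
  rewrite big_split /=; congr (_ * _).
  rewrite -[LHS](rev_prod k (fun b => \prod_(a < k) shift_ratio (k * m) (k * s + a + b).+1)).
  apply: eq_bigr => b _.
  by rewrite -[LHS](rev_prod k (fun a => shift_ratio (k * m) (k * s + a + (k.-1 - b)).+1)).
apply: ler_prod => b _; rewrite prodr_ge0 => [|a _]; last by rewrite sqr_ge0.
apply: ler_prod => a _; rewrite sqr_ge0 shift_ratio_pair //.
by have := ltn_ord a; have := ltn_ord b; lia.
Qed.

(** The triangle i < j < kp contains one k by k square for each pair i < j < p. What is left are
    small triangles on the diagonal, whose factors are at least 1. *)
Lemma layer_factor_scale m p k : (0 < k)%N -> lf m p ^+ (k ^ 2) <= lf (k * m) (k * p).
Proof.
move=> k0; rewrite /layer_factor (prod_blocks (fun j => \prod_(i < j) shift_ratio (k * m) (i + j).+1)).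
rewrite -prodrXl; apply: ler_prod => j _.
rewrite exprn_ge0 /=; last by apply: prodr_ge0 => i _; exact: shift_ratio_ge0.
apply: (@le_trans _ _ (\prod_(b < k) \prod_(i < k * j) shift_ratio (k * m) (i + (k * j + b)).+1)).
  under [X in _ <= X]eq_bigr do rewrite (prod_blocks (fun i => shift_ratio (k * m) (i + (k * j + _)).+1)).
  rewrite exchange_big /= -prodrXl; apply: ler_prod => i _.
  rewrite exprn_ge0 ?shift_ratio_ge0 //=; apply: le_trans (shift_ratio_block m (i + j) k0) _.
  rewrite le_eqVlt; apply/orP; left; apply/eqP; apply: eq_bigr => b _.
  by apply: eq_bigr => a _; congr (shift_ratio _ _); lia.
apply: ler_prod => b _; rewrite prodr_ge0 => [|i _]; last exact: shift_ratio_ge0.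
rewrite [X in _ <= X]big_split_ord /= ler_peMr ?prodr_ge0 // => [i _|]; first exact: shift_ratio_ge0.
by apply: (big_ind (fun x : R => 1 <= x)) => // [x y hx hy|i _]; [exact: mulr_ege1 | exact: shift_ratio_ge1].
Qed.

(** Multiply every block of an optimal composition by [k]. *)
Lemma v_scale n k : (0 < k)%N -> (0 < n)%N -> vR n ^+ (k ^ 2) <= vR (k * n).
Proof.
case: n => // n k0 _; have [bs [hb hs ->]] := v_attained R n.
have hk : sumn (map (muln k) bs) = (k * n.+1)%N.
  by rewrite -hs; elim: (bs) => [|p bs' IH] /=; rewrite ?muln0 // IH mulnDr.
have [n' hn'] : exists n', (k * n.+1 = n'.+1)%N by exists (k * n.+1).-1; rewrite prednK ?muln_gt0 ?k0.
have hb' : all (leq 1) (map (muln k) bs).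
  by rewrite all_map; apply: sub_all hb => p /=; rewrite muln_gt0 k0.
rewrite hn' in hk *; apply: le_trans (v_ge R hb' hk).
suff aux m : blocks_prod lf m bs ^+ (k ^ 2) <= blocks_prod lf (k * m) (map (muln k) bs).
  by rewrite /comp_value -[X in _ <= blocks_prod _ X _](muln0 k).
elim: bs m {hb hs hk hb'} => [|p bs IH] m; first by rewrite /= expr1n.
rewrite [blocks_prod _ m _]/= [blocks_prod _ (k * m) _]/= exprMn -mulnDr ler_pM //.
- by rewrite exprn_ge0 // ltW // layer_factor_gt0.
- by rewrite exprn_ge0 // (le_trans _ (comp_value_ge1 _ _ _)).
exact: layer_factor_scale.
Qed.

End Growth.

Local Open Scope classical_set_scope.
Local Open Scope ring_scope.

(** * Limits of superquadratic sequences *)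

Section QuadraticLimit.
Variable R : realType.
Implicit Types (f g : nat -> R) (L C : R).

Lemma cvg_quadratic f L :
  (forall n, (0 < n)%N -> f n <= L * n%:R ^+ 2) ->
  (forall e : R, 0 < e -> exists N, forall n, (N <= n)%N -> (0 < n)%N ->
      (L - e) * n%:R ^+ 2 <= f n) ->
  (fun n => f n / n%:R ^+ 2) @ \oo --> L.
Proof.
move=> hL hf; apply/cvgrPdist_le => e e0; have [N hN] := hf e e0.
exists N.+1 => // n /= Nn; have n0 : (0 < n)%N by exact: leq_trans Nn.
have n20 : 0 < n%:R ^+ 2 :> R by rewrite exprn_gt0 // ltr0n.
have h1 : f n / n%:R ^+ 2 <= L by rewrite ler_pdivrMr // hL.
have h2 : L - e <= f n / n%:R ^+ 2 by rewrite ler_pdivlMr // hN // ltnW.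
by rewrite ger0_norm ?subr_ge0 // lerBlDl -lerBlDr.
Qed.

Lemma cvg_quadratic_ge f L : (fun n => f n / n%:R ^+ 2) @ \oo --> L ->
  forall e : R, 0 < e -> exists N, forall n, (N <= n)%N -> (0 < n)%N ->
      (L - e) * n%:R ^+ 2 <= f n.
Proof.
move=> /cvgrPdist_le hL e e0; have [N _ hN] := hL e e0.
exists N => n Nn n0; have := hN n Nn => /=.
have n20 : 0 < n%:R ^+ 2 :> R by rewrite exprn_gt0 // ltr0n.
rewrite ler_distlC => /andP[h _]; rewrite -ler_pdivlMr //.
Qed.

Lemma nat_gt (x : R) : exists N, forall n, (N <= n)%N -> x < n%:R.
Proof.
exists (Num.bound `|x|) => n hn; apply: le_lt_trans (ler_norm x) _.
by apply: lt_le_trans (archi_boundP (normr_ge0 x)) _; rewrite ler_nat.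
Qed.

(** A Fekete lemma: the limit is the supremum of f(n)/n^2, approached from a near-optimal [m]
    through its multiples. *)
Lemma quadratic_fekete f C :
  (forall n, (0 < n)%N -> 0 <= f n) -> (forall n, (0 < n)%N -> f n <= f n.+1) ->
  (forall k n, (0 < k)%N -> (0 < n)%N -> k%:R ^+ 2 * f n <= f (k * n)%N) ->
  (forall n, (0 < n)%N -> f n <= C * n%:R ^+ 2) ->
  exists L, [/\ (fun n => f n / n%:R ^+ 2) @ \oo --> L,
    forall n, (0 < n)%N -> f n <= L * n%:R ^+ 2 & 0 <= L <= C].
Proof.
move=> f0 fS fk fC.
have sq0 n : (0 < n)%N -> 0 < n%:R ^+ 2 :> R by move=> n0; rewrite exprn_gt0 // ltr0n.
pose E := [set f n / n%:R ^+ 2 | n in [set n | (0 < n)%N]].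
have ubE : ubound E C by move=> _ [n /= n0 <-]; rewrite ler_pdivrMr ?sq0 ?fC.
have supE : has_sup E by split; [exists (f 1%N / 1%:R ^+ 2), 1%N | exists C].
have hL n : (0 < n)%N -> f n <= sup E * n%:R ^+ 2.
  move=> n0; rewrite -ler_pdivrMr ?sq0 //.
  by apply: (ub_le_sup (proj2 supE)); exists n.
have L0 : 0 <= sup E.
  have := hL 1%N isT; rewrite expr1n mulr1; exact: le_trans (f0 1%N isT).
have fmono a b : (0 < a)%N -> (a <= b)%N -> f a <= f b.
  move=> a0 ab; rewrite -(subnKC ab); elim: (b - a)%N => [|d IH]; first by rewrite addn0.
  by rewrite addnS (le_trans IH) // fS // addn_gt0 a0.
exists (sup E); split => //; last by rewrite L0 ge_sup //; exact: (proj1 supE).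
apply: cvg_quadratic => // e e0.
have e20 : 0 < e / 2 by rewrite divr_gt0.
have [_ [m /= m0 <-] hm] := sup_adherent e20 supE.
(* Replacing n by the multiple of [m] below it costs at most 2 m L n, which this threshold keeps
   below e n^2 / 2. *)
have [N hN] := nat_gt (4 * m%:R * sup E / e).
exists (N + m)%N => n hn n0.
have mn : (m <= n)%N by lia.
set k := (n %/ m)%N.
have k0 : (0 < k)%N by rewrite divn_gt0.
have kn : (k * m <= n)%N by rewrite leq_trunc_div.
have kn' : (n < k * m + m)%N by rewrite {1}(divn_eq n m) ltn_add2l ltn_mod.
have h1 : k%:R ^+ 2 * f m <= f n.
  apply: le_trans (fk _ _ k0 m0) _; apply: fmono => //.
  by rewrite muln_gt0 k0.
set L := sup E in hm hL L0 hN *.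
have h2 : (L - e / 2) * m%:R ^+ 2 <= f m by rewrite -ler_pdivlMr ?sq0 // ltW.
have h3 : 4 * m%:R * L < e * n%:R.
  by rewrite [e * _]mulrC -ltr_pdivrMr //; apply: hN; lia.
have h4 : (k * m)%:R <= n%:R :> R by rewrite ler_nat.
have h5 : n%:R <= (k * m)%:R + m%:R :> R by rewrite -natrD ler_nat ltnW.
apply: le_trans h1.
apply: (@le_trans _ _ (k%:R ^+ 2 * ((L - e / 2) * m%:R ^+ 2))); last first.
  by rewrite ler_wpM2l // sqr_ge0.
have -> : k%:R ^+ 2 * ((L - e / 2) * m%:R ^+ 2) = (L - e / 2) * (k * m)%:R ^+ 2.
  by rewrite natrM; ring.
move: (k * m)%:R h4 h5 => K h4 h5.
have n0' : 0 < n%:R :> R by rewrite ltr0n.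
have m0' : 0 < m%:R :> R by rewrite ltr0n.
have mn' : m%:R <= n%:R :> R by rewrite ler_nat.
have K0 : 0 <= K by lra.
move: n%:R m%:R h3 h4 h5 n0' m0' mn' => x y h3 h4 h5 x0 y0 yx.
have h6 : e / 2 * K ^+ 2 <= e / 2 * x ^+ 2.
  by rewrite ler_wpM2l ?(ltW e20) // lerXn2r ?nnegrE // ltW.
have h7 : L * (x ^+ 2 - K ^+ 2) <= L * (2 * y * x).
  by rewrite ler_wpM2l //; nra.
have h8 : 4 * y * L * x <= e * x * x by rewrite ler_wpM2r // ltW.
nra.
Qed.

Lemma cvg_half_quadratic f g L : 0 <= L ->
  (forall n, (0 < n)%N -> f n <= L * n%:R ^+ 2) ->
  (fun n => f n / n%:R ^+ 2) @ \oo --> L ->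
  (forall n, (1 < n)%N -> 2 * f n./2 <= g n <= 2 * f (uphalf n)) ->
  (fun n => g n / n%:R ^+ 2) @ \oo --> L / 2.
Proof.
move=> L0 fL cf hg; apply/cvgrPdist_le => e e0.
have [N hN] := cvg_quadratic_ge cf e0.
have [M hM] := nat_gt (2 * L / e).
exists (N.*2 + M + 2)%N => // n /= hn.
have n1 : (1 < n)%N by lia.
have /andP[h1 h2] := hg n n1.
have n20 : 0 < n%:R ^+ 2 :> R by rewrite exprn_gt0 // ltr0n; lia.
have h3 := fL (uphalf n) ltac:(lia).
have h4 := hN n./2 ltac:(lia) ltac:(lia).
have h5 : 2 * L < e * n%:R by rewrite [e * _]mulrC -ltr_pdivrMr //; apply: hM; lia.
have a1 : 2 * (uphalf n)%:R <= n%:R + 1 :> R by rewrite -natrM natr1 ler_nat; lia.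
have a2 : n%:R <= 2 * (n./2)%:R + 1 :> R by rewrite -natrM natr1 ler_nat; lia.
have a3 : 2 * (n./2)%:R <= n%:R :> R by rewrite -natrM ler_nat; lia.
have n1' : 2 <= n%:R :> R by rewrite ler_nat.
have b1 : 0 <= (uphalf n)%:R :> R by [].
have b2 : 0 <= n./2%:R :> R by [].
move: n%:R (uphalf n)%:R n./2%:R n20 h3 h4 h5 a1 a2 a3 n1' b1 b2 => x U h.
move=> x20 h3 h4 h5 a1 a2 a3 x2 U0 H0.
have c1 : 2 * L * x <= e * x * x by rewrite ler_wpM2r // ?(ltW h5) //; lra.
rewrite ler_distl; apply/andP; split.
  rewrite lerBlDr ler_pdivrMr //.
  have c2 : L * U ^+ 2 <= L * ((x + 1) / 2) ^+ 2.
    by rewrite ler_wpM2l // lerXn2r ?nnegrE //; lra.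
  have c3 : L * 2 <= L * x by rewrite ler_wpM2l.
  nra.
rewrite -lerBlDr ler_pdivlMr //.
have c2 : L * ((x - 1) / 2) ^+ 2 <= L * h ^+ 2.
  by rewrite ler_wpM2l // lerXn2r ?nnegrE //; lra.
have c3 : e * h ^+ 2 <= e * (x / 2) ^+ 2.
  by rewrite ler_wpM2l ?(ltW e0) // lerXn2r ?nnegrE //; lra.
nra.
Qed.

End QuadraticLimit.

(** * Asymptotics of the factors of v *)

Section RealCalculus.
Variable R : realType.
Implicit Types (f g df dg : R -> R) (x y a b c : R).

Lemma is_derive_add f g x a b : is_derive x 1 f a -> is_derive x 1 g b ->
  is_derive x 1 (fun t => f t + g t) (a + b).
Proof. by move=> hf hg; exact: is_deriveD. Qed.

Lemma is_derive_mul f g x a b : is_derive x 1 f a -> is_derive x 1 g b ->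
  is_derive x 1 (fun t => f t * g t) (f x * b + g x * a).
Proof. by move=> hf hg; exact: is_deriveM. Qed.

Lemma is_derive_affine a b x : is_derive x 1 (fun t => a + b * t) b.
Proof.
have h1 : is_derive x 1 (fun=> a : R) 0 by exact: is_derive_cst.
have h2 : is_derive x 1 (fun=> b : R) 0 by exact: is_derive_cst.
have h3 : is_derive x 1 (fun t : R => t) 1 by exact: is_derive_id.
have := is_derive_add h1 (is_derive_mul h2 h3).
by rewrite mulr1 mulr0 addr0 add0r.
Qed.

Lemma is_derive_comp_affine f a b x d : is_derive (a + b * x) 1 f d ->
  is_derive x 1 (fun t => f (a + b * t)) (b * d).
Proof.
move=> hf; rewrite mulrC.
exact: (@is_derive1_comp _ f (fun t => a + b * t) x d b hf (is_derive_affine a b x)).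
Qed.

Lemma mvt f df a b : a < b -> (forall x, a <= x <= b -> is_derive x 1 f (df x)) ->
  exists c, a < c < b /\ f b - f a = df c * (b - a).
Proof.
move=> ab hf.
have h1 x : x \in `]a, b[%R -> is_derive x 1 f (df x).
  by rewrite in_itv /= => /andP[ax xb]; apply: hf; rewrite !ltW.
have h2 : {within `[a, b], continuous f}.
  apply: derivable_within_continuous => x; rewrite in_itv /= => xab.
  by have [] := hf x xab.
have [c] := MVT ab h1 h2.
by rewrite in_itv /= => cab h; exists c.
Qed.

(** Two mean values replace the exact remainder: only the sign of the weight [w] matters for
    convexity arguments. *)
Lemma taylor1 f df ddf a b x y :
  (forall t, a < t < b -> is_derive t 1 f (df t)) ->
  (forall t, a < t < b -> is_derive t 1 df (ddf t)) ->
  a < x < b -> a < y < b -> x != y ->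
  exists c w, [/\ (x < c < y) || (y < c < x), 0 <= w & f y = f x + df x * (y - x) + ddf c * w].
Proof.
move=> hf hdf /andP[ax xb] /andP[ay yb]; rewrite neq_lt => /orP[xy|yx].
  have [z [/andP[xz zy] hz]] := mvt xy (fun t ht => hf t ltac:(lra)).
  have [c [/andP[xc cz] hc]] := mvt xz (fun t ht => hdf t ltac:(lra)).
  exists c, ((z - x) * (y - x)); split; first by rewrite xc (lt_trans cz zy).
    by rewrite mulr_ge0 ?subr_ge0 // ltW.
  have -> : df x = df z - ddf c * (z - x) by rewrite -hc; ring.
  have -> : f y = f x + df z * (y - x) by rewrite -hz; ring.
  ring.
have [z [/andP[yz zx] hz]] := mvt yx (fun t ht => hf t ltac:(lra)).
have [c [/andP[zc cx] hc]] := mvt zx (fun t ht => hdf t ltac:(lra)).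
exists c, ((x - z) * (x - y)); split; first by rewrite (lt_trans yz zc) cx orbT.
  by rewrite mulr_ge0 ?subr_ge0 // ltW.
have -> : df x = df z + ddf c * (x - z) by rewrite -hc; ring.
have -> : f y = f x - df z * (x - y) by rewrite -hz; ring.
ring.
Qed.

Lemma ln_le_sub1 x : 0 < x -> ln x <= x - 1.
Proof. by move=> x0; rewrite -[x in ln x](subrK 1) addrC; apply: le_ln1Dx; lra. Qed.

Definition xlnx x := x * ln x.
Definition xxlnx x := x * xlnx x.

Lemma is_derive_xlnx x : 0 < x -> is_derive x 1 xlnx (ln x + 1).
Proof.
move=> x0; have h1 : is_derive x 1 (fun t : R => t) 1 by exact: is_derive_id.
have h2 : is_derive x 1 (fun t : R => ln t) x^-1 by exact: is_derive1_ln.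
have := is_derive_mul h1 h2.
by rewrite mulfV ?gt_eqF // mulr1 addrC.
Qed.

Lemma is_derive_xxlnx x : 0 < x -> is_derive x 1 xxlnx (2 * xlnx x + x).
Proof.
move=> x0; have h1 : is_derive x 1 (fun t : R => t) 1 by exact: is_derive_id.
have := is_derive_mul h1 (is_derive_xlnx x0).
have -> : x * (ln x + 1) + xlnx x * 1 = 2 * xlnx x + x by rewrite /xlnx; ring.
by [].
Qed.

Lemma ln_ge_subV x : 0 < x -> 1 - x^-1 <= ln x.
Proof.
move=> x0; have := @ln_le_sub1 x^-1; rewrite invr_gt0 => /(_ x0).
by rewrite lnV ?posrE //; lra.
Qed.

Lemma xlnx_diff x : 0 < x -> ln x <= xlnx (x + 1) - xlnx x - 1 <= ln (x + 1).
Proof.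
move=> x0; have x10 : 0 < x + 1 by lra.
have h1 := @ln_le_sub1 ((x + 1) / x) ltac:(by rewrite divr_gt0).
have h2 := @ln_ge_subV ((x + 1) / x) ltac:(by rewrite divr_gt0).
rewrite ln_div ?posrE // in h1 h2.
have e1 : (x + 1) / x - 1 = x^-1 by field; rewrite gt_eqF.
have e2 : 1 - ((x + 1) / x)^-1 = (x + 1)^-1 by field; rewrite !gt_eqF.
rewrite e1 in h1; rewrite e2 in h2.
rewrite /xlnx; apply/andP; split.
  have := ler_wpM2l (ltW x10) h2; rewrite mulfV ?gt_eqF //; nra.
have := ler_wpM2l (ltW x0) h1; rewrite mulfV ?gt_eqF //; nra.
Qed.

(* A second antiderivative of [ln]: its second differences are local averages of [ln]. *)
Definition lnII x := xxlnx x / 2 - 3 / 4 * (x * x).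

Lemma is_derive_lnII x : 0 < x -> is_derive x 1 lnII (xlnx x - x).
Proof.
move=> x0.
have hc (t c : R) : is_derive t 1 (fun=> c) 0 by exact: is_derive_cst.
have h1 (t : R) : is_derive t 1 (fun t : R => t) 1 by exact: is_derive_id.
have h := is_derive_add (is_derive_mul (is_derive_xxlnx x0) (hc x 2^-1))
  (is_derive_mul (hc x (- (3 / 4))) (is_derive_mul (h1 x) (h1 x))).
have e1 : (fun t => xxlnx t * 2^-1 + - (3 / 4) * (t * t)) = lnII.
  by apply/funext => t; rewrite /lnII; ring.
by rewrite e1 in h; apply: (is_derive_eq h); field.
Qed.

Definition lnII_diff2 x := lnII (x + 1) - 2 * lnII x + lnII (x - 1).

(** One mean value turns the second difference into a first difference of x ln x, which [xlnx_diff]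
    encloses between logarithms. For k = 1 the interval touches 0, where [lnII] is not known to be
    differentiable, so this case is computed. *)
Lemma lnII_diff2_near k : (0 < k)%N -> `|lnII_diff2 k%:R - ln k%:R| <= 2 / k%:R.
Proof.
case: k => // -[_|k _].
  rewrite mulr1n /lnII_diff2 /lnII /xxlnx /xlnx subrr ln1 divr1 mul0r.
  have h1 := @ln_le_sub1 (1 + 1) ltac:(lra).
  have h2 : 0 <= ln (1 + 1 : R) by apply: ln_ge0; lra.
  rewrite ler_norml; apply/andP; split; lra.
set x : R := k.+2%:R.
have x2 : 2 <= x by rewrite /x ler_nat.
pose f (t : R) := lnII (1 + 1 * t) + (-1) * lnII (0 + 1 * t).
have hf t : x - 1 <= t <= x -> is_derive t 1 f
    (1 * (xlnx (1 + 1 * t) - (1 + 1 * t)) +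
     ((-1) * (1 * (xlnx (0 + 1 * t) - (0 + 1 * t))) + lnII (0 + 1 * t) * 0)).
  move=> /andP[t1 t2].
  have p1 : 0 < 1 + 1 * t by lra.
  have p0 : 0 < 0 + 1 * t by lra.
  have hc : is_derive t 1 (fun=> -1 : R) 0 by exact: is_derive_cst.
  exact: (is_derive_add (is_derive_comp_affine (is_derive_lnII p1))
    (is_derive_mul hc (is_derive_comp_affine (is_derive_lnII p0)))).
have lt1 : x - 1 < x by lra.
have [c [/andP[c1 c2] hc]] := mvt lt1 hf.
have c0 : 0 < c by lra.
have /andP[h1 h2] := xlnx_diff c0.
have e1 : lnII_diff2 x = xlnx (c + 1) - xlnx c - 1.
  have n1 : 1 + 1 * (x - 1) = x by ring.
  have n2 : 0 + 1 * (x - 1) = x - 1 by ring.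
  have n3 : 1 + 1 * x = x + 1 by ring.
  have n4 : 0 + 1 * x = x by ring.
  have n5 : 1 + 1 * c = c + 1 by ring.
  have n6 : 0 + 1 * c = c by ring.
  have n7 : x - (x - 1) = 1 by ring.
  by move: hc; rewrite /f /lnII_diff2 n1 n2 n3 n4 n5 n6 n7; lra.
rewrite e1.
have l1 : ln (c + 1) <= ln (x + 1) by rewrite ler_ln ?posrE; lra.
have l2 : ln (x - 1) <= ln c by rewrite ler_ln ?posrE; lra.
have l3 : ln (x + 1) - ln x <= x^-1.
  have := @ln_le_sub1 ((x + 1) / x); rewrite divr_gt0; [|lra|lra].
  rewrite ln_div ?posrE; [|lra|lra].
  have -> : (x + 1) / x - 1 = x^-1 by field; rewrite gt_eqF //; lra.
  exact.
have l4 : - (2 / x) <= ln (x - 1) - ln x.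
  have := @ln_ge_subV ((x - 1) / x); rewrite divr_gt0; [|lra|lra].
  rewrite ln_div ?posrE; [|lra|lra].
  move=> /(_ isT); apply: le_trans.
  have -> : 1 - ((x - 1) / x)^-1 = - (x - 1)^-1 by field; rewrite !gt_eqF //; lra.
  have -> : 2 / x = (x / 2)^-1 by field; rewrite gt_eqF //; lra.
  rewrite lerN2 lef_pV2 ?posrE; lra.
have l5 : x^-1 <= 2 / x by rewrite ler_peMl ?invr_ge0; lra.
rewrite ler_norml; apply/andP; split.
  by apply: le_trans l4 _; rewrite lerD2r (le_trans l2).
by rewrite lerBlDr (le_trans h2) // (le_trans l1) // -lerBlDr (le_trans l3).
Qed.

End RealCalculus.

(** * Comparison of the layer factors with integrals *)

Section LayerAsymptotics.
Variable R : realType.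
Notation lf := (layer_factor R).

Lemma ln_prod (I : Type) (r : seq I) (F : I -> R) : (forall i, 0 < F i) ->
  ln (\prod_(i <- r) F i) = \sum_(i <- r) ln (F i).
Proof.
move=> F0; elim: r => [|i r IH]; first by rewrite !big_nil ln1.
by rewrite !big_cons lnM ?IH ?posrE ?F0 // prodr_gt0.
Qed.

Lemma sum_square_symmetric (a : nat -> R) p :
  \sum_(i < p) \sum_(j < p) a (i + j)%N =
  2 * (\sum_(j < p) \sum_(i < j) a (i + j)%N) + \sum_(i < p) a (i + i)%N.
Proof.
elim: p => [|p IH]; first by rewrite !big_ord0; ring.
rewrite big_ord_recr /=.
under eq_bigr do rewrite big_ord_recr /=.
rewrite big_split /= IH !big_ord_recr /=.
have -> : \sum_(i < p) a (p + i)%N = \sum_(i < p) a (i + p)%N.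
  by apply: eq_bigr => i _; rewrite addnC.
ring.
Qed.

(** Keeps the total error linear in p: enlarging the square adds 2p+1 terms, each at most
    1/(p+1). *)
Lemma sum_harmonic_square p :
  \sum_(i < p) \sum_(j < p) (i + j).+1%:R^-1 <= 2 * p%:R :> R.
Proof.
rewrite (sum_square_symmetric (fun c => c.+1%:R^-1)).
elim: p => [|p IH]; first by rewrite !big_ord0; lra.
rewrite !big_ord_recr /= -[p.+1%:R]natr1.
move: IH; set A := (\sum_(j < p) \sum_(i < j) _); set B := (\sum_(i < p) (i + i).+1%:R^-1).
suff : 2 * (\sum_(i < p) (i + p).+1%:R^-1) + (p + p).+1%:R^-1 <= 2 :> R.
  by move: A B (\sum_(i < p) _) ((p + p).+1%:R^-1) => A B C d; lra.
move=> {A B}.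
apply: (@le_trans _ _ (2 * (p%:R * p.+1%:R^-1) + p.+1%:R^-1)).
  apply: lerD; last by rewrite lef_pV2 ?posrE ?ltr0n // ler_nat; lia.
  rewrite ler_wpM2l // mulr_natl -[X in _ *+ X]card_ord -sumr_const; apply: ler_sum => i _.
  by rewrite lef_pV2 ?posrE ?ltr0n // ler_nat; lia.
have p0 : 0 <= p%:R :> R by [].
rewrite -[p.+1]addn1 natrD.
move: p%:R p0 => x x0.
have -> : 2 * (x / (x + 1)) + (x + 1)^-1 = 2 - (x + 1)^-1 by field; lra.
by rewrite lerBlDr lerDl invr_ge0; lra.
Qed.

Lemma sum_lnII_diff2 (x : R) p : \sum_(i < p) \sum_(j < p) lnII_diff2 (x + (i + j).+1%:R) =
  lnII (x + 2 * p%:R) - 2 * lnII (x + p%:R) + lnII x.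
Proof.
pose D (y : R) := lnII (y + 1) - lnII y.
have CD (y : R) k : \sum_(j < k) lnII_diff2 (y + j.+1%:R) = D (y + k%:R) - D y.
  elim: k => [|k IH]; first by rewrite big_ord0 addr0 subrr.
  rewrite big_ord_recr /= IH /D /lnII_diff2 -[k.+1]addn1 natrD.
  have -> : y + (k%:R + 1) - 1 = y + k%:R by ring.
  have -> : y + k%:R + 1 = y + (k%:R + 1) by ring.
  ring.
have SD (y : R) k : \sum_(i < k) D (y + i%:R) = lnII (y + k%:R) - lnII y.
  elim: k => [|k IH]; first by rewrite big_ord0 addr0 subrr.
  rewrite big_ord_recr /= IH /D -[k.+1]addn1 natrD.
  have -> : y + k%:R + 1 = y + (k%:R + 1) by ring.
  ring.
transitivity (\sum_(i < p) (D (x + p%:R + i%:R) - D (x + i%:R))).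
  apply: eq_bigr => i _.
  have -> : x + p%:R + i%:R = x + i%:R + p%:R by ring.
  by rewrite -CD; apply: eq_bigr => j _; rewrite -addnS natrD addrA.
rewrite sumrB !SD.
have -> : x + p%:R + p%:R = x + 2 * p%:R by ring.
ring.
Qed.

(** The approximation of 2 ln F(m, p): the sum over the p by p square of second differences of
    [lnII] telescopes to its four corners. *)
Definition phi2 (m p : R) : R :=
  (lnII (2 * m + 2 * p) - 2 * lnII (2 * m + p) + lnII (2 * m)) -
  (lnII (2 * p) - 2 * lnII p + lnII 0).

Lemma ln_layer_factor m p : 2 * ln (lf m p) =
  \sum_(i < p) \sum_(j < p) ln (shift_ratio R m (i + j).+1) - \sum_(i < p) ln (shift_ratio R m (i + i).+1).
Proof.
have r0 c : 0 < shift_ratio R m c.+1 by apply: lt_le_trans (shift_ratio_ge1 _ _ _).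
rewrite (sum_square_symmetric (fun c => ln (shift_ratio R m c.+1))) addrK /layer_factor.
rewrite ln_prod => [|j]; last by apply: prodr_gt0 => i _; exact: r0.
by congr (2 * _); apply: eq_bigr => j _; rewrite ln_prod => [|i]; last exact: r0.
Qed.

Lemma ln_shift_ratio m c : ln (shift_ratio R m c.+1) = ln (2 * m%:R + c.+1%:R) - ln c.+1%:R.
Proof.
rewrite /shift_ratio ln_div ?posrE ?ltr0n //; last by rewrite addnS.
by rewrite natrD natrM.
Qed.

Lemma sum_ln_shift_ratio_near m p :
  `|\sum_(i < p) \sum_(j < p) ln (shift_ratio R m (i + j).+1) - phi2 m%:R p%:R| <= 8 * p%:R.
Proof.
have -> : phi2 m%:R p%:R = \sum_(i < p) \sum_(j < p)
    (lnII_diff2 (2 * m%:R + (i + j).+1%:R) - lnII_diff2 (0 + (i + j).+1%:R)).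
  under eq_bigr do rewrite sumrB.
  by rewrite sumrB !sum_lnII_diff2 /phi2 !add0r.
rewrite -sumrB; apply: le_trans (ler_norm_sum _ _ _) _.
apply: (@le_trans _ _ (\sum_(i < p) \sum_(j < p) 4 * (i + j).+1%:R^-1)); last first.
  under eq_bigr do rewrite -mulr_sumr.
  by rewrite -mulr_sumr; have := sum_harmonic_square p; lra.
apply: ler_sum => i _; rewrite -sumrB; apply: le_trans (ler_norm_sum _ _ _) _.
apply: ler_sum => j _; rewrite ln_shift_ratio add0r.
set c := (i + j).+1.
have h1 := lnII_diff2_near R (ltn0Sn (i + j)).
have h2 := lnII_diff2_near R (ltn0Sn (2 * m + (i + j))).
rewrite -addnS -/c natrD natrM in h2.
rewrite -/c in h1.
have h3 : 2 / (2 * m%:R + c%:R) <= 2 / c%:R :> R.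
  have c0 : 0 < c%:R :> R by rewrite ltr0n.
  have m0 : 0 <= 2 * m%:R :> R by rewrite mulr_ge0.
  by rewrite ler_wpM2l // lef_pV2 ?posrE //; lra.
move: h1 h2 h3; rewrite !ler_norml => /andP[a1 a2] /andP[b1 b2] h3.
by apply/andP; split; lra.
Qed.

Lemma ln_layer_factor_upper m p : 2 * ln (lf m p) <= phi2 m%:R p%:R + 8 * p%:R.
Proof.
have := sum_ln_shift_ratio_near m p; rewrite ler_norml => /andP[_ h].
rewrite ln_layer_factor.
have : 0 <= \sum_(i < p) ln (shift_ratio R m (i + i).+1).
  by apply: sumr_ge0 => i _; apply: ln_ge0; exact: shift_ratio_ge1.
lra.
Qed.

Lemma ln_layer_factor_lower m p :
  phi2 m%:R p%:R - (8 * p%:R + p%:R * ln (2 * m%:R + 1)) <= 2 * ln (lf m p).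
Proof.
have := sum_ln_shift_ratio_near m p; rewrite ler_norml => /andP[h _].
rewrite ln_layer_factor.
have : \sum_(i < p) ln (shift_ratio R m (i + i).+1) <= p%:R * ln (2 * m%:R + 1).
  rewrite mulr_natl -[X in _ *+ X]card_ord -sumr_const; apply: ler_sum => i _.
  have c1 : 1 <= (i + i).+1%:R :> R by rewrite ler1n.
  have m0 : 0 <= 2 * m%:R :> R by rewrite mulr_ge0.
  rewrite ler_ln ?posrE; [|exact: lt_le_trans (shift_ratio_ge1 _ _ _)|lra].
  rewrite /shift_ratio natrD natrM ler_pdivrMr; last by lra.
  by move: c1 m0; move: (2 * m%:R) (_%:R) => x y c1 m0; nra.
lra.
Qed.

(** The function h of the overview. In [phi2E] the terms in ln n and the quadratic terms of [lnII]
    cancel, so [phi2] is homogeneous of degree 2. *)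
Definition entropy (t : R) : R :=
  4 * (1 - t) * ln 2 - xxlnx (2 - t) + 2 * xxlnx (1 - t) - xxlnx t.

Lemma phi2E (n t : R) : 0 < n -> 0 < t < 1 ->
  phi2 (n * (1 - t)) (n * t) = n ^+ 2 * entropy t.
Proof.
move=> n0 /andP[t0 t1].
rewrite /phi2 /entropy /lnII /xxlnx /xlnx.
have -> : 2 * (n * (1 - t)) + 2 * (n * t) = 2 * n by ring.
have -> : 2 * (n * (1 - t)) + n * t = n * (2 - t) by ring.
rewrite mul0r.
have l1 : ln (2 * n) = ln 2 + ln n by rewrite lnM ?posrE.
have l2 : ln (n * (2 - t)) = ln n + ln (2 - t) by rewrite lnM ?posrE //; lra.
have l3 : ln (2 * (n * (1 - t))) = ln 2 + (ln n + ln (1 - t)).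
  have p1 : 0 < 1 - t by lra.
  by rewrite lnM ?posrE ?mulr_gt0 // lnM ?posrE.
have l4 : ln (2 * (n * t)) = ln 2 + (ln n + ln t).
  by rewrite lnM ?posrE ?mulr_gt0 // lnM ?posrE.
have l5 : ln (n * t) = ln n + ln t by rewrite lnM ?posrE.
by rewrite l1 l2 l3 l4 l5; field.
Qed.

Lemma le_of_scaled (x y : R) : (forall k, (0 < k)%N -> k%:R * x <= y) -> x <= 0.
Proof.
move=> h; rewrite leNgt; apply/negP => x0.
have [N hN] := nat_gt (y / x).
have := h N.+1 isT; rewrite leNgt => /negP; apply.
by rewrite -ltr_pdivrMr // hN.
Qed.

Lemma phi2_entropy k m p : (0 < k)%N -> (0 < m)%N -> (0 < p)%N ->
  phi2 (k * m)%:R (k * p)%:R =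
  k%:R ^+ 2 * ((m%:R + p%:R) ^+ 2 * entropy (p%:R / (m%:R + p%:R))).
Proof.
move=> k0 m0 p0.
have k0' : 0 < k%:R :> R by rewrite ltr0n.
have m0' : 0 < m%:R :> R by rewrite ltr0n.
have p0' : 0 < p%:R :> R by rewrite ltr0n.
have n0 : 0 < m%:R + p%:R :> R by rewrite addr_gt0.
rewrite !natrM mulrA -exprMn -phi2E.
- by congr phi2; field; rewrite gt_eqF.
- by rewrite mulr_gt0.
by rewrite divr_gt0 //= ltr_pdivrMr // mul1r ltrDr.
Qed.

(** A power trick: at (km, kp) the left side grows at least like k^2, [phi2] exactly like k^2, and
    the error only like k, so the error disappears. *)
Lemma ln_layer_factor_le_phi2 m p : 2 * ln (lf m p) <= phi2 m%:R p%:R.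
Proof.
have phi0 (x : R) : phi2 0 x = 0 by rewrite /phi2 mulr0 !add0r subrr.
case: m => [|m].
  suff -> : lf 0 p = 1 by rewrite ln1 mulr0 phi0.
  rewrite /layer_factor big1 // => j _; rewrite big1 // => i _.
  by rewrite muln0 add0n divff ?pnatr_eq0.
case: p => [|p].
  rewrite /layer_factor big_ord0 ln1 mulr0 /phi2 !mulr0 !addr0.
  by set a := lnII _; set b := lnII _; lra.
rewrite -subr_le0; apply: (@le_of_scaled _ (8 * p.+1%:R)) => k k0.
have := ln_layer_factor_upper (k * m.+1) (k * p.+1).
have := @phi2_entropy 1 m.+1 p.+1 isT isT isT; rewrite !mul1n expr1n mul1r => ->.
rewrite phi2_entropy //.
have : k%:R ^+ 2 * ln (lf m.+1 p.+1) <= ln (lf (k * m.+1) (k * p.+1)).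
  rewrite -natrX mulr_natl -lnXn ?layer_factor_gt0 //.
  rewrite ler_ln ?posrE ?exprn_gt0 ?layer_factor_gt0 //.
  exact: layer_factor_scale.
rewrite natrM; have k0' : 0 < k%:R :> R by rewrite ltr0n.
move: ((m.+1%:R + p.+1%:R) ^+ 2 * entropy _) (ln (lf (k * _) _)) (ln (lf m.+1 _)) => e b a h1 h2.
rewrite -(ler_pM2l k0'); move: k%:R k0' h1 h2 => x x0 h1 h2; nra.
Qed.

End LayerAsymptotics.

(** * The entropy bound *)

Section EntropyBound.
Variable R : realType.
Implicit Types t x y c : R.

Lemma ln_ratio_bounds (n : nat) : (0 < n)%N ->
  n%:R * ln (n.+1%:R / n%:R : R) <= 1 <= n.+1%:R * ln (n.+1%:R / n%:R : R).
Proof.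
move=> n0; have n0' : 0 < n%:R :> R by rewrite ltr0n.
rewrite -[n.+1]addn1 natrD; move: n%:R n0' => x x0.
have y0 : 0 < (x + 1) / x by rewrite divr_gt0 //; lra.
have := ln_le_sub1 y0; have := ln_ge_subV y0.
have -> : (x + 1) / x - 1 = x^-1 by field; rewrite gt_eqF.
have -> : 1 - ((x + 1) / x)^-1 = (x + 1)^-1 by field; rewrite !gt_eqF //; lra.
move=> h1 h2; apply/andP; split.
  by rewrite mulrC -ler_pdivlMr // div1r.
by rewrite mulrC -ler_pdivrMr ?div1r //; lra.
Qed.

Definition smooth_ln (a b c d e f g : nat) : R :=
  a%:R * ln 2 + b%:R * ln 3 + c%:R * ln 5 + d%:R * ln 7 + e%:R * ln 11 + f%:R * ln 13 + g%:R * ln 23.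

Lemma ln_smooth (n a b c d e f g : nat) :
  n%:R = 2 ^+ a * 3 ^+ b * 5 ^+ c * 7 ^+ d * 11 ^+ e * 13 ^+ f * 23 ^+ g :> R ->
  ln n%:R = smooth_ln a b c d e f g.
Proof.
move=> ->; rewrite !lnM ?posrE ?mulr_gt0 ?exprn_gt0 ?ltr0n //.
by rewrite !lnXn ?ltr0n // /smooth_ln !mulr_natl.
Qed.

(** Two consecutive integers composed of the seven primes confine an integer combination of their
    logarithms to a short interval. *)
Lemma smooth_bounds (n a b c d e f g a' b' c' d' e' f' g' : nat) : (0 < n)%N ->
  n%:R = 2 ^+ a * 3 ^+ b * 5 ^+ c * 7 ^+ d * 11 ^+ e * 13 ^+ f * 23 ^+ g :> R ->
  n.+1%:R = 2 ^+ a' * 3 ^+ b' * 5 ^+ c' * 7 ^+ d' * 11 ^+ e' * 13 ^+ f' * 23 ^+ g' :> R ->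
  n%:R * (smooth_ln a' b' c' d' e' f' g' - smooth_ln a b c d e f g) <= 1 <=
  n.+1%:R * (smooth_ln a' b' c' d' e' f' g' - smooth_ln a b c d e f g).
Proof.
move=> n0 h1 h2; rewrite -(ln_smooth h1) -(ln_smooth h2) -ln_div ?posrE ?ltr0n //.
exact: ln_ratio_bounds.
Qed.

(** Nonpositive exactly when the quotient of the overview is at most [c], for t in (0,1). *)
Definition gap c t := entropy t - 2 * c * (t * (2 - t)).

Definition dgap c t :=
  - 4 * ln 2 + 2 * xlnx (2 - t) - 4 * xlnx (1 - t) - 2 * xlnx t - 4 * c * (1 - t).

Definition ddgap c t := - 2 * ln (2 - t) + 4 * ln (1 - t) - 2 * ln t + 4 * c.

(** The constants bracket gamma / ln 2 between 0.2931 and 0.29329, just narrow enough for the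
    required digits of its half. The factors 80 and 49 come from 2t(2-t) = 80/49 at t = 4/7. *)
Lemma gap_numerics (c := (29 + 329 / 1000) / 100 * ln 2 : R) :
  [/\ gap c (13 / 23) + dgap c (13 / 23) * (4 / 7 - 13 / 23) <= 0, 0 <= dgap c (13 / 23),
   ddgap c (13 / 23) <= 0, gap c (4 / 7) <= 0 &
   dgap c (4 / 7) <= 0 /\ 80 * ((29 + 31 / 100) / 100 * ln 2) < 49 * entropy (4 / 7 : R)].
Proof.
(* Seven pairs for seven unknown logarithms; the exponents are the factorisations of n and n+1, such
   as 506 = 2 * 11 * 23 and 507 = 3 * 13^2. *)
have b0 := @smooth_bounds 506
  1 0 0 0 1 0 1 0 1 0 0 0 2 0 isT ltac:(ring) ltac:(ring).
have b1 := @smooth_bounds 528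
  4 1 0 0 1 0 0 0 0 0 0 0 0 2 isT ltac:(ring) ltac:(ring).
have b2 := @smooth_bounds 539
  0 0 0 2 1 0 0 2 3 1 0 0 0 0 isT ltac:(ring) ltac:(ring).
have b3 := @smooth_bounds 575
  0 0 2 0 0 0 1 6 2 0 0 0 0 0 isT ltac:(ring) ltac:(ring).
have b4 := @smooth_bounds 624
  4 1 0 0 0 1 0 0 0 4 0 0 0 0 isT ltac:(ring) ltac:(ring).
have b5 := @smooth_bounds 675
  0 3 2 0 0 0 0 2 0 0 0 0 2 0 isT ltac:(ring) ltac:(ring).
have b6 := @smooth_bounds 728
  3 0 0 1 0 1 0 0 6 0 0 0 0 0 isT ltac:(ring) ltac:(ring).
rewrite /smooth_ln in b0 b1 b2 b3 b4 b5 b6.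
rewrite /gap /dgap /ddgap /entropy /xxlnx /xlnx /c.
have -> : 2 - 13 / 23 = 3 * 11 / 23 :> R by field.
have -> : 1 - 13 / 23 = 2 * 5 / 23 :> R by field.
have -> : 2 - 4 / 7 = 2 * 5 / 7 :> R by field.
have -> : 1 - 4 / 7 = 3 / 7 :> R by field.
rewrite !ln_div ?posrE ?mulr_gt0 ?ltr0n //.
rewrite !lnM ?posrE ?ltr0n //.
have l4 : ln 4 = 2 * ln 2 :> R.
  by rewrite (_ : 4 = 2 * 2 :> R) ?lnM ?posrE ?ltr0n //; ring.
rewrite l4.
move: (ln 2) (ln 3) (ln 5) (ln 7) (ln 11) (ln 13) (ln 23) b0 b1 b2 b3 b4 b5 b6.
move=> l2 l3 l5 l7 l11 l13 l23.
move=> /andP[a0 b0] /andP[a1 b1] /andP[a2 b2] /andP[a3 b3] /andP[a4 b4] /andP[a5 b5] /andP[a6 b6].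
split; [lra|lra|lra|lra|split; lra].
Qed.
End EntropyBound.

(** * Sign of the gap function *)

Section EntropyMaximum.
Variable R : realType.
Implicit Types t x y c : R.

Lemma is_derive_dgap c t : 0 < t < 1 ->
  is_derive t 1 (gap c) (dgap c t) /\ is_derive t 1 (dgap c) (ddgap c t).
Proof.
move=> /andP[t0 t1].
have hc (k : R) : is_derive t 1 (fun=> k) 0 by exact: is_derive_cst.
have p2 : 0 < 2 + (-1) * t by lra.
have p1 : 0 < 1 + (-1) * t by lra.
have a2 := is_derive_affine 2 (-1) t.
have a1 := is_derive_affine 1 (-1) t.
have a0 := is_derive_affine 0 1 t.
have X2 := is_derive_comp_affine (is_derive_xxlnx p2).
have X1 := is_derive_comp_affine (is_derive_xxlnx p1).
have X0 := is_derive_xxlnx t0.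
have x2 := is_derive_comp_affine (is_derive_xlnx p2).
have x1 := is_derive_comp_affine (is_derive_xlnx p1).
have x0 := is_derive_xlnx t0.
split.
  have h := is_derive_add (is_derive_mul (hc (4 * ln 2)) a1)
    (is_derive_add (is_derive_mul (hc (-1)) X2) (is_derive_add (is_derive_mul (hc 2) X1)
    (is_derive_add (is_derive_mul (hc (-1)) X0)
      (is_derive_mul (hc (- 2 * c)) (is_derive_mul a0 a2))))).
  have e : (fun u : R => 4 * ln 2 * (1 + -1 * u) + (-1 * xxlnx (2 + -1 * u) +
      (2 * xxlnx (1 + -1 * u) + (-1 * xxlnx u + - 2 * c * ((0 + 1 * u) * (2 + -1 * u)))))) = gap c.
    apply/funext => u; rewrite /gap /entropy.
    have -> : 2 + -1 * u = 2 - u by ring.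
    have -> : 1 + -1 * u = 1 - u by ring.
    ring.
  rewrite e in h; apply: (is_derive_eq h); rewrite /dgap.
  have -> : 2 + -1 * t = 2 - t by ring.
  have -> : 1 + -1 * t = 1 - t by ring.
  by ring.
have h := is_derive_add (hc (-4 * ln 2)) (is_derive_add (is_derive_mul (hc 2) x2)
    (is_derive_add (is_derive_mul (hc (-4)) x1) (is_derive_add (is_derive_mul (hc (-2)) x0)
      (is_derive_mul (hc (- 4 * c)) a1)))).
have e : (fun u : R => -4 * ln 2 + (2 * xlnx (2 + -1 * u) + (-4 * xlnx (1 + -1 * u) +
    (-2 * xlnx u + - 4 * c * (1 + -1 * u))))) = dgap c.
  apply/funext => u; rewrite /dgap.
  have -> : 2 + -1 * u = 2 - u by ring.
  have -> : 1 + -1 * u = 1 - u by ring.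
  ring.
rewrite e in h; apply: (is_derive_eq h); rewrite /ddgap.
have -> : 2 + -1 * t = 2 - t by ring.
have -> : 1 + -1 * t = 1 - t by ring.
by ring.
Qed.

Lemma ddgap_decreasing c x y : 0 < x -> x <= y -> y < 1 -> ddgap c y <= ddgap c x.
Proof.
move=> x0 xy y1; rewrite /ddgap.
have h1 : ln (1 - y) <= ln (1 - x) by rewrite ler_ln ?posrE; lra.
have h2 : ln (x * (2 - x)) <= ln (y * (2 - y)).
  by rewrite ler_ln ?posrE ?mulr_gt0; [nra|lra..].
move: h2; rewrite !lnM ?posrE; [lra|lra..].
Qed.

(** Stands in for the limit 0 of [gap] at 0, where the derivatives are not at hand. *)
Lemma gap_near0 c t : 0 <= c -> 0 < t < 1 -> gap c t <= 3 * t.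
Proof.
move=> c0 /andP[t0 t1]; rewrite /gap /entropy /xxlnx /xlnx.
have l0 : 0 <= ln 2 :> R by apply: ln_ge0; lra.
have p2 : 0 < 2 - t by lra.
have h2 : ln 2 - ln (2 - t) <= t / (2 - t).
  have := @ln_le_sub1 R (2 / (2 - t)); rewrite divr_gt0 // ln_div ?posrE //.
  have -> : 2 / (2 - t) - 1 = t / (2 - t) by field; lra.
  exact.
have h2' : (2 - t) * ((2 - t) * ln 2) - t * (2 - t) <= (2 - t) * ((2 - t) * ln (2 - t)).
  have -> : t * (2 - t) = (2 - t) * ((2 - t) * (t / (2 - t))) by field; lra.
  by rewrite -mulrBr -mulrBr !ler_pM2l //; lra.
have h1 : (1 - t) * ((1 - t) * ln (1 - t)) <= 0.
  by rewrite !pmulr_rle0 ?ln_le0; lra.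
have h0 : t * (t * (1 - t^-1)) <= t * (t * ln t).
  by rewrite !ler_pM2l // ln_ge_subV.
have e0 : t * (t * (1 - t^-1)) = t * t - t by field; rewrite gt_eqF.
rewrite e0 in h0.
have h3 : 0 <= c * (t * (2 - t)) by rewrite !mulr_ge0 // ltW.
have h4 : 0 <= t * t * ln 2 by rewrite !mulr_ge0 // ltW.
have h5 : 0 <= t * t by rewrite mulr_ge0 // ltW.
lra.
Qed.

(* On [t, 1) the function is concave once its second derivative is negative,
   and the tangents at 13/23 and 4/7, on both sides of the maximum, stay below 0.
   Where it is convex, a positive value would propagate either to 0 or to 13/23. *)
Lemma gap_le0 c t : 0 <= c ->
  gap c (13 / 23) + dgap c (13 / 23) * (4 / 7 - 13 / 23) <= 0 ->
  0 <= dgap c (13 / 23) -> ddgap c (13 / 23) <= 0 ->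
  gap c (4 / 7) <= 0 -> dgap c (4 / 7) <= 0 ->
  0 < t < 1 -> gap c t <= 0.
Proof.
move=> c0; set a : R := 13 / 23; set b : R := 4 / 7 => ha da dda hb db /andP[t0 t1].
have a01 : 0 < a < 1 by rewrite /a; apply/andP; split; lra.
have b01 : 0 < b < 1 by rewrite /b; apply/andP; split; lra.
have ab : a < b by rewrite /a /b; lra.
have D1 x : 0 < x < 1 -> is_derive x 1 (gap c) (dgap c x) by move=> /(is_derive_dgap c) [].
have D2 x : 0 < x < 1 -> is_derive x 1 (dgap c) (ddgap c x) by move=> /(is_derive_dgap c) [].
have t01 : 0 < t < 1 by rewrite t0.
have ga : gap c a <= 0.
  by have : 0 <= dgap c a * (b - a) by [rewrite mulr_ge0 // subr_ge0 ltW]; lra.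
have right x : a <= x < 1 -> ddgap c x <= 0.
  move=> /andP[ax x1]; apply: le_trans (ddgap_decreasing c _ ax x1) dda.
  by case/andP: a01.
have tan x y : 0 < x < 1 -> 0 < y < 1 -> x != y ->
    (forall e, (x < e < y) || (y < e < x) -> ddgap c e <= 0) ->
    gap c y <= gap c x + dgap c x * (y - x).
  move=> x01 y01 xy he; have [e [w [hxy w0 ->]]] := taylor1 D1 D2 x01 y01 xy.
  by rewrite gerDl mulr_le0_ge0 // he.
have [tb|bt] := ltP b t.
  apply: le_trans (tan b t b01 t01 _ _) _; first by rewrite lt_eqF.
    by move=> e /orP[/andP[be et]|/andP[te eb]]; apply: right; apply/andP; split; lra.
  have : dgap c b * (t - b) <= 0 by rewrite mulr_le0_ge0 // subr_ge0 ltW.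
  lra.
have [ta|ta|->] := ltgtP t a; last by [].
  have hta : dgap c a * (t - a) <= 0 by rewrite mulr_ge0_le0 // subr_le0 ltW.
  have [dt|dt] := leP (ddgap c t) 0.
    apply: le_trans (tan a t a01 t01 _ _) _; [by rewrite gt_eqF| |lra].
    move=> e /orP[/andP[ae et]|/andP[te ea]]; first by lra.
    by apply: le_trans (ddgap_decreasing c t0 (ltW te) _) dt; lra.
  rewrite leNgt; apply/negP => gt0.
  have [dt0|dt0] := ltP (dgap c t) 0.
    (* By convexity and the negative slope, [gap c s] is at least [gap c t], whereas this [s]
       satisfies 3 s < [gap c t]. *)
    pose s := Num.min (gap c t / 4) (t / 2).
    have s0 : 0 < s by rewrite lt_min !divr_gt0.
    have s1 : s <= gap c t / 4 by rewrite ge_min lexx.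
    have s2 : s <= t / 2 by rewrite ge_min lexx orbT.
    have s01 : 0 < s < 1 by rewrite s0; lra.
    have ts : t != s by rewrite gt_eqF //; lra.
    have [e [w [he w0 hs]]] := taylor1 D1 D2 t01 s01 ts.
    have := gap_near0 c0 s01; rewrite hs.
    have h1 : 0 <= dgap c t * (s - t) by rewrite mulr_le0 ?(ltW dt0) //; lra.
    have h2 : 0 <= ddgap c e * w.
      rewrite mulr_ge0 //; case/orP: he => /andP[e1 e2]; first by lra.
      by apply: le_trans (ltW dt) (ddgap_decreasing c _ _ _); lra.
    lra.
  (* The slope is nonnegative at [t] and at [a] but negative in between: it falls and then rises,
     against the monotonicity of [ddgap]. *)
  have [x [/andP[tx xa] hx]] := mvt ta (fun u (hu : t <= u <= a) => D1 u ltac:(lra)).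
  have dx : dgap c x < 0.
    rewrite ltNge; apply/negP => dx.
    have : 0 <= dgap c x * (a - t) by rewrite mulr_ge0 // subr_ge0 ltW.
    lra.
  have [y [/andP[ty yx] hy]] := mvt tx (fun u (hu : t <= u <= x) => D2 u ltac:(lra)).
  have [z [/andP[xz za] hz]] := mvt xa (fun u (hu : x <= u <= a) => D2 u ltac:(lra)).
  have dy : ddgap c y < 0.
    rewrite ltNge; apply/negP => dy.
    have : 0 <= ddgap c y * (x - t) by rewrite mulr_ge0 // subr_ge0 ltW.
    lra.
  have : ddgap c z <= ddgap c y by apply: ddgap_decreasing; lra.
  have : ddgap c z * (a - x) < 0 -> False by lra.
  by move=> hF hzy; apply: hF; rewrite nmulr_rlt0 ?subr_gt0 //; lra.
(* Between the two points the tangent at [a] increases, so its value at [b] bounds it. *)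
apply: le_trans (tan a t a01 t01 _ _) _; first by rewrite lt_eqF.
  by move=> e /orP[/andP[ae et]|/andP[te ea]]; apply: right; apply/andP; split; lra.
have : dgap c a * (t - a) <= dgap c a * (b - a) by rewrite ler_wpM2l // lerB.
lra.
Qed.

End EntropyMaximum.

(** * The theorem *)

Section MainTheorem.
Variable R : realType.
Notation lf := (layer_factor R).
Notation vR n := ((v n)%:~R : R).
Notation vtR n := ((vtilde n)%:~R : R).

Lemma ln_layer_factor_le c m p : 0 <= c ->
  (forall t, 0 < t < 1 -> gap c t <= 0) ->
  ln (lf m p) <= c * (((m + p)%:R) ^+ 2 - m%:R ^+ 2).
Proof.
move=> c0 hc; rewrite natrD.
have rhs0 : 0 <= c * ((m%:R + p%:R) ^+ 2 - m%:R ^+ 2).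
  rewrite mulr_ge0 //.
  have -> : (m%:R + p%:R) ^+ 2 - m%:R ^+ 2 = p%:R * (2 * m%:R + p%:R) :> R by ring.
  by rewrite mulr_ge0 // addr_ge0 // mulr_ge0.
have := ln_layer_factor_le_phi2 R m p.
have phi0 (x : R) : phi2 0 x = 0 by rewrite /phi2 mulr0 !add0r subrr.
case: m rhs0 => [|m] rhs0.
  by rewrite phi0; lra.
case: p rhs0 => [|p] rhs0.
  have -> : phi2 m.+1%:R 0 = 0 :> R.
    by rewrite /phi2 !mulr0 !addr0; set a := lnII _; set b := lnII _; lra.
  by lra.
have := @phi2_entropy R 1 m.+1 p.+1 isT isT isT; rewrite !mul1n expr1n mul1r => ->.
have x0 : 0 < m.+1%:R :> R by rewrite ltr0n.
have y0 : 0 < p.+1%:R :> R by rewrite ltr0n.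
move: (lf m.+1 p.+1) (m.+1%:R) (p.+1%:R) x0 y0 {rhs0} => F x y x0 y0 h.
have n0 : 0 < x + y by rewrite addr_gt0.
have t01 : 0 < y / (x + y) < 1.
  by rewrite divr_gt0 //= ltr_pdivrMr // mul1r ltrDr.
have := hc _ t01; rewrite /gap subr_le0 => hg.
have : (x + y) ^+ 2 * entropy (y / (x + y)) <=
       (x + y) ^+ 2 * (2 * c * (y / (x + y) * (2 - y / (x + y)))).
  by rewrite ler_wpM2l // sqr_ge0.
have -> : (x + y) ^+ 2 * (2 * c * (y / (x + y) * (2 - y / (x + y)))) =
    2 * (c * ((x + y) ^+ 2 - x ^+ 2)) by field; rewrite gt_eqF.
lra.
Qed.

Lemma ln_comp_value_le c m bs : 0 <= c -> (forall t, 0 < t < 1 -> gap c t <= 0) ->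
  ln (comp_value R m bs) <= c * (((m + sumn bs)%:R) ^+ 2 - m%:R ^+ 2).
Proof.
move=> c0 hc; elim: bs m => [|p bs IH] m /=.
  by rewrite /comp_value /= ln1 addn0 subrr mulr0.
rewrite /comp_value /= lnM ?posrE ?layer_factor_gt0 //; last first.
  exact: lt_le_trans (comp_value_ge1 _ _ _).
have := lerD (ln_layer_factor_le m p c0 hc) (IH (m + p)%N).
by rewrite addnA -mulrDr [_ - _ + _]addrC addrA subrK.
Qed.

Lemma ln_v_quadratic (c : R) : 0 <= c -> (forall t, 0 < t < 1 -> gap c t <= 0) ->
  exists L : R, [/\ (fun n : nat => ln (vR n) / n%:R ^+ 2) @ \oo --> L,
    forall n, (0 < n)%N -> ln (vR n) <= L * n%:R ^+ 2 & 0 <= L <= c].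
Proof.
move=> c0 hc; apply: quadratic_fekete => [n n0|n n0|k n k0 n0|n n0].
- by apply: ln_ge0; exact: v_ge1.
- rewrite ler_ln ?posrE ?v_leS //; apply: lt_le_trans (v_ge1 _ _) => //.
- rewrite -natrX mulr_natl -lnXn; last by apply: lt_le_trans (v_ge1 _ _).
  rewrite ler_ln ?posrE ?v_scale ?exprn_gt0 //.
    by apply: lt_le_trans (v_ge1 _ _).
  by apply: lt_le_trans (v_ge1 _ _); rewrite // muln_gt0 k0.
case: n n0 => // n _; have [bs [_ hs ->]] := v_attained R n.
by have := ln_comp_value_le 0 bs c0 hc; rewrite add0n hs expr0n subr0.
Qed.

(** Appending a block of 4k letters to an optimal composition of 3k gives 49 L >= 9 L + 49 h(4/7) /
    2 in the limit, that is 80 L >= 49 h(4/7). *)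
Lemma ln_v_lower (L d : R) :
  (fun n : nat => ln (vR n) / n%:R ^+ 2) @ \oo --> L ->
  (forall n, (0 < n)%N -> ln (vR n) <= L * n%:R ^+ 2) ->
  80 * d < 49 * entropy (4 / 7 : R) -> d < L.
Proof.
move=> cL hL hd; rewrite ltNge; apply/negP => Ld.
pose D := 49 * entropy (4 / 7 : R) - 80 * L.
have D0 : 0 < D by rewrite /D; lra.
(* This tolerance at 3k costs 2 * 9 k^2 * D/36 = D k^2 / 2, half of the surplus. *)
have e0 : 0 < D / 36 by rewrite divr_gt0.
have [N hN] := cvg_quadratic_ge cL e0.
have [M hM] := nat_gt (112 / D).
(* With k = j^2 the logarithm in the error is at most 6j, so the error is at most 32 j^2 + 24 j^3 <=
   56 j^3, beaten by (D/2) j^4 as soon as D j > 112. *)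
pose j := (N + M).+1; pose k := (j * j)%N.
have k0 : (0 < k)%N by [].
have Nk : (N <= 3 * k)%N by rewrite /k /j; nia.
have h1 := hN (3 * k)%N Nk ltac:(by rewrite muln_gt0).
have h2 := hL (7 * k)%N ltac:(by rewrite muln_gt0).
have h3 : ln (vR (3 * k)%N) + ln (lf (3 * k) (4 * k)) <= ln (vR (7 * k)%N).
  have v0 n : (0 < n)%N -> 0 < vR n by move=> n0; apply: lt_le_trans (v_ge1 _ _).
  rewrite -lnM ?posrE ?layer_factor_gt0 ?v0 ?muln_gt0 //.
  rewrite ler_ln ?posrE ?mulr_gt0 ?layer_factor_gt0 ?v0 ?muln_gt0 //.
  have -> : (7 * k = 3 * k + 4 * k)%N by rewrite -mulnDl.
  by apply: v_step; rewrite muln_gt0.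
have h4 := ln_layer_factor_lower R (3 * k) (4 * k).
rewrite ![(_ * k)%N]mulnC in h4 h3 h2 h1.
rewrite phi2_entropy // in h4.
have e1 : 4%:R / (3%:R + 4%:R) = 4 / 7 :> R by field.
rewrite e1 in h4.
have j1 : 1 <= j%:R :> R by rewrite ler1n.
have hl : ln (2 * (k * 3)%:R + 1) <= 6 * j%:R :> R.
  apply: (@le_trans _ _ (ln ((3 * j%:R) ^+ 2))).
    have p1 : 0 < 2 * (k * 3)%:R + 1 :> R by rewrite ltr_wpDl ?mulr_ge0.
    have p2 : 0 < (3 * j%:R) ^+ 2 :> R by rewrite exprn_gt0 // mulr_gt0 //; lra.
    by rewrite ler_ln ?posrE // /k !natrM; nra.
  rewrite lnXn; last by lra.
  have := @ln_le_sub1 R (3 * j%:R) ltac:(lra).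
  by rewrite mulr2n; lra.
have hj : 112 < D * j%:R.
  rewrite [D * _]mulrC -ltr_pdivrMr // hM // /j; lia.
rewrite !natrM in h1 h2 h4 hl.
have h5 : j%:R * j%:R * 4 * ln (2 * (j%:R * j%:R * 3) + 1) <= j%:R * j%:R * 4 * (6 * j%:R) :> R.
  by rewrite ler_wpM2l // !mulr_ge0.
have DE : 49 * entropy (4 / 7 : R) = D + 80 * L by rewrite /D; ring.
have p3 : 56 * j%:R ^+ 3 < D / 2 * j%:R ^+ 4 :> R.
  have -> : D / 2 * j%:R ^+ 4 = (D * j%:R) * (j%:R ^+ 3 / 2) :> R by field.
  have -> : 56 * j%:R ^+ 3 = 112 * (j%:R ^+ 3 / 2) :> R by field.
  by rewrite ltr_pM2r // divr_gt0 // exprn_gt0 //; lra.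
have p4 : 32 * j%:R ^+ 2 <= 32 * j%:R ^+ 3 :> R.
  by rewrite ler_wpM2l // [_ ^+ 3]exprS ler_peMl // sqr_ge0.
have DE' : j%:R ^+ 4 * (49 * entropy (4 / 7 : R)) = j%:R ^+ 4 * (D + 80 * L) by rewrite DE.
clear -h1 h2 h3 h4 h5 p3 p4 DE'.
lra.
Qed.

End MainTheorem.

Unset Implicit Arguments.

Theorem theorem1p6 (R : realType) :
  let a (n : nat) : R := log2 (v n)%:~R / n%:R ^+ 2 in
  let a' (n : nat) : R := log2 (vtilde n)%:~R / n%:R ^+ 2 in
  exists gamma : R,
    [/\ (fun n : nat => ln (v n)%:~R / n%:R ^+ 2 : R) @ \oo --> gamma,
        cvgn a /\ cvgn a',
        limn a' = 2^-1 * limn a,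
        2^-1 * limn a = gamma / (2 * ln 2)
      & `|gamma / (2 * ln 2) - 1466 / 10 ^+ 4| < 5 / 10 ^+ 5].
Proof.
move=> a a'.
have l20 : 0 < ln 2 :> R by rewrite ln_gt0 // ltr1n.
have [n1 n2 n3 n4 [n5 n6]] := gap_numerics R.
set c : R := (29 + 329 / 1000) / 100 * ln 2 in n1 n2 n3 n4 n5.
have c0 : 0 <= c by rewrite /c mulr_ge0 // ?ltW //; lra.
have hgap t : 0 < t < 1 -> gap c t <= 0 by exact: gap_le0.
have [L [cL hL /andP[L0 Lc]]] := ln_v_quadratic c0 hgap.
have Ld := ln_v_lower cL hL n6.
have cvg_log2 (u : nat -> R) (l : R) : (fun n => ln (u n) / n%:R ^+ 2) @ \oo --> l ->
    (fun n => log2 (u n) / n%:R ^+ 2) @ \oo --> l / ln 2.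
  move=> hu; have -> : (fun n => log2 (u n) / n%:R ^+ 2) =
      (fun n => ln (u n) / n%:R ^+ 2 * (ln 2)^-1).
    by apply/funext => n; rewrite /log2 mulrAC.
  exact: (cvgM hu (cvg_cst _)).
have ca : a @ \oo --> L / ln 2 by exact: cvg_log2.
have v0 n : (0 < n)%N -> 0 < (v n)%:~R :> R by move=> n0; apply: lt_le_trans (v_ge1 _ _).
have ca' : a' @ \oo --> L / 2 / ln 2.
  apply: cvg_log2; apply: (cvg_half_quadratic L0 hL cL) => n n1'.
  have h1 : (0 < n./2)%N by rewrite half_gt0.
  have h2 : (0 < uphalf n)%N by rewrite uphalf_gt0 ltnW.
  have /andP[s1 s2] := square_vtilde R n1'.
  have vt0 : 0 < (vtilde n)%:~R :> R by apply: lt_le_trans s1; rewrite exprn_gt0 // v0.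
  rewrite ![2 * _]mulr_natl -!lnXn ?v0 //.
  by rewrite !ler_ln ?posrE ?exprn_gt0 ?v0 // s1.
have limE (u : nat -> R) (l : R) : u @ \oo --> l -> limn u = l.
  by move=> hu; apply: cvg_lim => //; exact: norm_hausdorff.
exists L; split => //.
- by split; apply/cvg_ex; [exists (L / ln 2) | exists (L / 2 / ln 2)].
- by rewrite (limE _ _ ca) (limE _ _ ca'); field; rewrite gt_eqF.
- by rewrite (limE _ _ ca); field; rewrite gt_eqF.
have -> : L / (2 * ln 2) = L / ln 2 / 2 by field; rewrite gt_eqF.
(* Halved, the bounds read 0.14655 < gamma / (2 ln 2) <= 0.146645, within 0.00005 of 0.1466. *)
have b1 : (29 + 31 / 100) / 100 < L / ln 2 by rewrite ltr_pdivlMr.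
have b2 : L / ln 2 <= (29 + 329 / 1000) / 100 by rewrite ler_pdivrMr.
rewrite ltr_norml; move: (L / ln 2) b1 b2 => x b1 b2.
have e4 : 10 ^+ 4 = 100 * 100 :> R by ring.
have e5 : 10 ^+ 5 = 100 * 1000 :> R by ring.
by rewrite e4 e5; apply/andP; split; lra.
Qed.
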